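(* Let $K\ge3$ and $a_{ij}>0$ for all $i\neq j$. For almost every $(\mu,\omega)\in\mathbb{R}^2$ (with respect to Lebesgue measure) there exists an entire solution of the rotating segregated system in $\mathbb{R}^2$, that is, a $K$-tuple $(u_1,\dots,u_K)\in(H^1_{\mathrm{loc}}(\mathbb{R}^2))^K$ with $u_i\ge0$, $u_i\not\equiv0$ for every $i$, such that, for every $i$, $$-\Delta u_i+\omega\,\mathbf{x}^\perp\cdot\nabla u_i\le\mu u_i,\qquad -\Delta\widehat u_i+\omega\,\mathbf{x}^\perp\cdot\nabla\widehat u_i\ge\mu\widehat u_i\quad\text{in }\mathbb{R}^2,\qquad u_iu_j=0\ \text{ for } i\ne j.$$
   Context: For $\mathbf{x}=(x_1,x_2)\in\mathbb{R}^2$, $\mathbf{x}^\perp=(-x_2,x_1)$, and $\widehat u_i=u_i-\sum_{j\neq i}\frac{a_{ij}}{a_{ji}}u_j$. The differential inequalities are understood in the weak sense (tested against non-negative Lipschitz functions with compact support in $\mathbb{R}^2$). *)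

(* Defs.v *)
From HB Require Import structures.
From mathcomp Require Import all_boot all_order all_algebra.
From mathcomp Require Import all_classical all_reals all_analysis.
Set Implicit Arguments.
Unset Strict Implicit.
Unset Printing Implicit Defensive.
Import Order.TTheory GRing.Theory Num.Theory.
Import numFieldNormedType.Exports.
Local Open Scope classical_set_scope.
Local Open Scope ring_scope.

Notation plane_measure R := (@lebesgue_measure R \x @lebesgue_measure R)%E.

Definition e1 (R : realType) : R * R := (1, 0).

Definition e2 (R : realType) : R * R := (0, 1).

Definition dot2 (R : realType) (p q : R * R) : R := p.1 * q.1 + p.2 * q.2.

Definition perp (R : realType) (x : R * R) : R * R := (- x.2, x.1).

Definition compact_support (R : realType) (f : R * R -> R) : Prop :=
  compact (closure [set x | f x != 0]).

Definition L2loc (R : realType) (f : R * R -> R) : Prop :=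
  measurable_fun setT f /\
  forall A : set (R * R), compact A ->
    (\int[plane_measure R]_(x in A) (f x ^+ 2)%:E < +oo)%E.

Definition C1_partial (R : realType) (v : R * R) (f : R * R -> R) : Prop :=
  (forall x, derivable f x v) /\ continuous ('D_v f).

Definition C1c (R : realType) (f : R * R -> R) : Prop :=
  [/\ continuous f, C1_partial (e1 R) f, C1_partial (e2 R) f
    & compact_support f].

(* Weak derivatives are tested against compactly supported C^1 functions, as in
   Gilbarg-Trudinger, Section 7.3. *)
Definition weak_derivative (R : realType) (v : R * R) (f g : R * R -> R)
    : Prop :=
  forall psi : R * R -> R, C1c psi ->
    \int[plane_measure R]_x (f x * 'D_v psi x) =
    - \int[plane_measure R]_x (g x * psi x).

Definition weak_gradient (R : realType) (f : R * R -> R) (g : R * R -> R * R)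
    : Prop :=
  [/\ L2loc (fst \o g), L2loc (snd \o g),
      weak_derivative (e1 R) f (fst \o g)
    & weak_derivative (e2 R) f (snd \o g)].

Definition H1loc (R : realType) (f : R * R -> R) : Prop :=
  L2loc f /\ exists g, weak_gradient f g.

(* [lipschitz] refers to the sup norm of R * R, which is equivalent to the
   Euclidean one. *)
Definition admissible_test (R : realType) (phi : R * R -> R) : Prop :=
  [/\ lipschitz phi, compact_support phi & forall x, 0 <= phi x].

(* The left-hand side of the weak formulation of
   -Delta f + omega x^perp . grad f, where g = grad f and h = grad phi. *)
Definition rotating_form (R : realType) (omega : R) (g : R * R -> R * R)
    (phi : R * R -> R) (h : R * R -> R * R) : R :=
  \int[plane_measure R]_x
    (dot2 (g x) (h x) + omega * dot2 (perp x) (g x) * phi x).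

(* The gradient h of the test function is its weak gradient: it exists for every
   Lipschitz phi and agrees a.e. with the pointwise one (Rademacher), so
   quantifying over h neither restricts phi nor depends on the choice of h.
   Likewise g is unique up to a null set. *)
Definition weak_subsolution (R : realType) (mu omega : R) (f : R * R -> R)
    : Prop :=
  exists2 g, weak_gradient f g &
    forall phi h, admissible_test phi -> weak_gradient phi h ->
      rotating_form omega g phi h <=
      \int[plane_measure R]_x (mu * f x * phi x).

Definition weak_supersolution (R : realType) (mu omega : R) (f : R * R -> R)
    : Prop :=
  exists2 g, weak_gradient f g &
    forall phi h, admissible_test phi -> weak_gradient phi h ->
      \int[plane_measure R]_x (mu * f x * phi x) <=
      rotating_form omega g phi h.

Definition hatu (R : realType) (K : nat) (a : 'I_K -> 'I_K -> R)
    (u : 'I_K -> R * R -> R) (i : 'I_K) : R * R -> R :=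
  fun x => u i x - \sum_(j < K | j != i) a i j / a j i * u j x.

(* Elements of H^1_loc are classes of functions modulo a.e. equality, here given
   by Borel representatives; pointwise relations between them hold a.e. *)
Definition entire_segregated_solution (R : realType) (K : nat)
    (a : 'I_K -> 'I_K -> R) (mu omega : R) (u : 'I_K -> R * R -> R) : Prop :=
  [/\ forall i, H1loc (u i),
      forall i, {ae (plane_measure R), forall x, 0 <= u i x},
      forall i, ~ {ae (plane_measure R), forall x, u i x = 0},
      forall i, weak_subsolution mu omega (u i) /\
                weak_supersolution mu omega (hatu a u i)
    & forall i j, i != j -> {ae (plane_measure R), forall x, u i x * u j x = 0}].

(* Main.v *)
(** For omega <> 0 write z = x_1 + i x_2 and N = 2 (K - 1).  The function
    W = Re (z^N g(|z|^2)) solves the equation exactly when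
    s g'' + (N + 1) g' = (i omega N - mu) g / 4, whose entire solution with g(0) = 1
    has no zero on [0, +oo[ by a Wronskian argument.  Hence g = |g| e^{i phi} with
    phi continuous, and {W < 0} splits into N spiral sectors, which are grouped
    into K - 1 relatively clopen sets A_j.  Take W^+ as one component, i0, and
    b_j W^- 1_{A_j}, b_j = a_{j i0} / a_{i0 j}, as the others.  Each is a
    subsolution, the hat of the component i0 is W itself, and the hat of the
    component j is - b_j W minus nonnegative multiples of subsolutions. *)
Require Import Defs.
From HB Require Import structures.
From mathcomp Require Import all_boot all_order all_algebra.
From mathcomp Require Import all_classical all_reals all_analysis.
From mathcomp Require Import measurable_realfun ring lra.
Import Order.TTheory GRing.Theory Num.Theory.
Import numFieldNormedType.Exports.
Local Open Scope classical_set_scope.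
Local Open Scope ring_scope.
Set Implicit Arguments.
Unset Strict Implicit.
Unset Printing Implicit Defensive.

(** * Locally bounded functions and dominated convergence *)

(** The coefficients carry no symmetry. Cutting one smooth [W] into weighted pieces forces the
    weights of two adjacent components i, j to have ratio a_ij / a_ji, and around a cycle of
    adjacent components such ratios need not multiply to 1. A star has no cycle, and for two leaves
    the coefficients enter a hat only through a term of favourable sign. For omega = 0 the factor g
    is real and may vanish on circles; the imaginary coefficient omega N / 4 is what makes the
    Wronskian of Re g and Im g strictly monotone on the positive axis. N is even so that, after
    straightening the spirals, both halves of the horizontal axis lie in {W > 0}. An arccosine on
    the upper half-plane then tells K - 1 sectors apart without any branch of the argument; all
    sectors below the axis join the first class. The nodal curves cross at the origin, so
    integrations by parts are done with C^1 cutoffs of [- W] rather than on the sectors. The limit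
    is dominated because t times the derivative of the step at t is bounded uniformly in the
    steepness. *)

Lemma open_measurable_plane {R : realType} (U : set (R * R)) : open U -> measurable U.
Proof.
move=> oU.
(* The sigma-algebra on the plane is the product one, so [U] is written as a countable union of
   rectangles with rational centres and radii 1/(n+1). *)
pose B (i : (rat * rat) * nat) : set (R * R) :=
  ball (ratr i.1.1 : R) i.2.+1%:R^-1 `*` ball (ratr i.1.2 : R) i.2.+1%:R^-1.
pose F i := if `[< B i `<=` U >] then B i else set0.
have -> : U = \bigcup_i F i.
  apply/seteqP; split=> [x Ux|x [i _]]; last first.
    by rewrite /F; case: asboolP => // + Bx; apply.
  have /nbhs_ballP[e /= e0 eU] : nbhs x U by apply: open_nbhs_nbhs; split.
  have [n _ /(_ n (leqnn n)) ne] := near_infty_natSinv_lt (PosNum (divr_gt0 e0 (ltr0n R 2))).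
  have d0 : 0 < n.+1%:R^-1 :> R by rewrite invr_gt0.
  have rat_ball (t : R) : exists q : rat, ball (ratr q : R) n.+1%:R^-1 t.
    have [||y [/= by_ [q _ qy]]] := @dense_rat R (ball t n.+1%:R^-1); [|exact: ball_open|].
      by exists t; exact: ballxx.
    by exists q; rewrite qy; apply: ball_sym.
  have [q1 h1] := rat_ball x.1; have [q2 h2] := rat_ball x.2.
  exists ((q1, q2), n) => //; rewrite /F.
  have Bx : B ((q1, q2), n) x by [].
  case: asboolP => // BU; exfalso; apply: BU => y [y1 y2]; apply: eU; split => /=.
    by rewrite (splitr e); apply: (@ball_triangle _ _ (ratr q1 : R));
      [apply: ball_sym; exact: le_ball (ltW ne) _ h1 | exact: le_ball (ltW ne) _ y1].
  by rewrite (splitr e); apply: (@ball_triangle _ _ (ratr q2 : R));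
      [apply: ball_sym; exact: le_ball (ltW ne) _ h2 | exact: le_ball (ltW ne) _ y2].
apply: countable_bigcupT_measurable; first exact: countableP.
move=> i; rewrite /F; case: asboolP => // _.
by apply: measurableX; exact: measurable_ball.
Qed.

Lemma continuous_measurable_plane {R : realType} (f : R * R -> R) :
  continuous f -> measurable_fun setT f.
Proof.
move=> /continuousP cf; apply: (measurability (@RGenOInfty.G R)).
  exact: RGenOInfty.measurableE.
move=> _ [_ [x ->] <-]; rewrite setTI.
apply: open_measurable_plane; apply: cf; exact: interval_open.
Qed.

Section plane_integration.
Context {R : realType}.
Implicit Types (f g h k psi : R * R -> R) (M : R).
Local Notation mu := (plane_measure R).

Definition vanishes_outside M f := forall x, M < `|x| -> f x = 0.

Definition cbox M : set (R * R) := `[- M, M] `*` `[- M, M].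

Lemma cboxE M x : cbox M x <-> `|x| <= M.
Proof.
rewrite /cbox/= !in_itv/= -!ler_norml prod_normE ge_max.
by split=> [[-> ->]//|/andP].
Qed.

Lemma compact_cbox M : compact (cbox M).
Proof. by apply: compact_setX; exact: segment_compact. Qed.

Lemma measurable_cbox M : measurable (cbox M).
Proof. by apply: measurableX; exact: measurable_itv. Qed.

Lemma cbox_lty M : (mu (cbox M) < +oo)%E.
Proof.
rewrite product_measure1E; [|exact: measurable_itv|exact: measurable_itv].
rewrite /= !lebesgue_measure_itv/=; case: ifPn => _; last by rewrite mule0 ltry.
by rewrite -EFinB -EFinM ltry.
Qed.

Lemma compact_supportP f : compact_support f <-> exists M, vanishes_outside M f.
Proof.
split=> [cf|[M fM]].
  have [M [_ hM]] := compact_bounded cf; exists (M + 1) => x Mx.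
  apply/eqP; apply: contraTT Mx => fx; rewrite -leNgt.
  by apply: hM; [rewrite ltrDl|exact: subset_closure].
apply: (subclosed_compact _ (@compact_cbox M)); first exact: closed_closure.
have cC : closed (cbox M) by apply: compact_closed; [exact: norm_hausdorff|exact: compact_cbox].
rewrite [X in _ `<=` X]((closure_id _).1 cC); apply: closure_subset => x /= fx.
by apply/cboxE; rewrite leNgt; apply/negP => /fM/eqP; rewrite (negbTE fx).
Qed.

(** This class contains continuous functions and indicators, is stable under sums and products, and
    lies in [L2loc]. It is also a class of multipliers for integrable functions that vanish outside
    a box, so nearly all integrability claims reduce to it. *)
Definition locbounded f :=
  measurable_fun setT f /\ forall M, exists C : R, forall x : R * R, `|x| <= M -> `|f x| <= C.

Lemma locbounded_cont f : continuous f -> locbounded f.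
Proof.
move=> cf; split; first exact: continuous_measurable_plane.
move=> M; have := compact_bounded (continuous_compact (continuous_subspaceT cf) (@compact_cbox M)).
move=> [C [_ hC]]; exists (C + 1) => x xM.
by apply: (hC (C + 1)); [rewrite ltrDl|exists x => //; exact/cboxE].
Qed.

Lemma locbounded_cst (c : R) : locbounded (fun=> c).
Proof. by split => // M; exists `|c|. Qed.

Lemma locboundedD f g : locbounded f -> locbounded g -> locbounded (fun x => f x + g x).
Proof.
move=> [mf bf] [mg bg]; split; first exact: measurable_funD.
move=> M; have [C hC] := bf M; have [D hD] := bg M; exists (C + D) => x xM.
by rewrite (le_trans (ler_normD _ _))// lerD ?hC ?hD.
Qed.

Lemma locboundedM f g : locbounded f -> locbounded g -> locbounded (fun x => f x * g x).
Proof.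
move=> [mf bf] [mg bg]; split; first exact: measurable_funM.
move=> M; have [C hC] := bf M; have [D hD] := bg M; exists (C * D) => x xM.
by rewrite normrM ler_pM ?hC ?hD.
Qed.

Lemma locboundedN f : locbounded f -> locbounded (fun x => - f x).
Proof.
move=> [mf bf]; split; first exact: measurableT_comp.
by move=> M; have [C hC] := bf M; exists C => x xM; rewrite normrN hC.
Qed.

Lemma locbounded_indic (A : set (R * R)) : measurable A -> locbounded (\1_A).
Proof.
move=> mA; split; first exact: measurable_indic.
by move=> M; exists 1 => x _; rewrite indicE; case: (_ \in _); rewrite /= ?normr0 ?normr1.
Qed.

Lemma integrable_cbox M : mu.-integrable setT (EFin \o \1_(cbox M)).
Proof.
apply/integrableP; split.
  by apply/measurable_EFinP; apply: measurable_indic; exact: measurable_cbox.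
under eq_integral do rewrite /= ger0_norm//.
by rewrite integral_indic ?setIT; [exact: cbox_lty| |exact: measurable_cbox].
Qed.

Lemma integrable_locbounded M f : locbounded f -> vanishes_outside M f ->
  mu.-integrable setT (EFin \o f).
Proof.
move=> [mf bf] fM; have [C hC] := bf M.
have mi : mu.-integrable setT (EFin \o (fun x => C * \1_(cbox M) x)).
  exact: (@integrableZl _ _ _ mu setT measurableT C _ (integrable_cbox M)).
apply: le_integrable mi => //; first exact/measurable_EFinP.
move=> x _ /=; rewrite lee_fin.
have [xM|Mx] := leP `|x| M; last by rewrite fM// normr0.
by rewrite indicE mem_set ?mulr1; [rewrite (le_trans (hC x xM))// ler_norm|exact/cboxE].
Qed.

Lemma integrableM_locbounded M f g : mu.-integrable setT (EFin \o f) ->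
  vanishes_outside M f -> locbounded g ->
  mu.-integrable setT (EFin \o (fun x => f x * g x)).
Proof.
move=> fi fM [mg bg]; have [C hC] := bg M.
have mf : measurable_fun setT f by apply/measurable_EFinP; exact: measurable_int fi.
have mi := @integrableZl _ _ _ mu setT measurableT C _ fi.
apply: le_integrable mi => //; first by apply/measurable_EFinP; exact: measurable_funM.
move=> x _ /=; rewrite lee_fin mulrC !normrM.
have [xM|Mx] := leP `|x| M; last by rewrite fM// normr0 !mulr0.
by rewrite ler_wpM2r// (le_trans (hC x xM))// ler_norm.
Qed.

Lemma locbounded_L2loc f : locbounded f -> L2loc f.
Proof.
move=> [mf bf]; split=> // A cA.
have [M [_ hM]] := compact_bounded cA; have AM x : A x -> `|x| <= M + 1.
  by apply: hM; rewrite ltrDl.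
have mA : measurable A.
  rewrite -(setCK A); apply: measurableC; apply: open_measurable_plane.
  by rewrite openC; apply: compact_closed => //; exact: norm_hausdorff.
have lbf : locbounded (fun x => \1_A x * f x ^+ 2).
  by apply: locboundedM; [exact: locbounded_indic|apply: (locboundedM (f := f) (g := f))].
have : mu.-integrable setT (EFin \o (fun x => \1_A x * f x ^+ 2)).
  apply: (integrable_locbounded (M := M + 1)) => // x xM.
  by rewrite indicE memNset ?mul0r// => /AM; rewrite leNgt xM.
move=> /integrableP[_]; apply: le_lt_trans.
rewrite integral_mkcond; apply: ge0_le_integral => //.
- by move=> x _; rewrite patchE; case: ifP => // _; rewrite lee_fin sqr_ge0.
- apply/(measurable_restrictT _ _).1 => //; apply: measurable_funTS.
  by apply/measurable_EFinP; exact: measurable_funX.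
- by apply/measurableT_comp => //; apply/measurable_EFinP; case: lbf.
- move=> x _; rewrite patchE /= indicE; case: (_ \in _); rewrite /= ?lee_fin //.
  by rewrite mul1r ler_norm.
Qed.

Lemma L2loc_cbox M h : L2loc h ->
  mu.-integrable setT (EFin \o (fun x => \1_(cbox M) x * h x)).
Proof.
move=> [mh /(_ _ (@compact_cbox M)) ih].
have mb := measurable_cbox M.
have i1 : mu.-integrable (cbox M) (EFin \o (fun x => h x ^+ 2)).
  apply/integrableP; split.
    by apply: measurable_funTS; apply/measurable_EFinP; exact: measurable_funX.
  by under eq_integral do rewrite /= ger0_norm ?sqr_ge0//.
have i2 : mu.-integrable setT (EFin \o (fun x => \1_(cbox M) x * h x ^+ 2)).
  suff -> : EFin \o (fun x => \1_(cbox M) x * h x ^+ 2) =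
      (EFin \o (fun x => h x ^+ 2)) \_ (cbox M).
    exact: (@integrable_mkcond _ _ R mu (cbox M) (EFin \o (fun x => h x ^+ 2)) mb).1 i1.
  apply/funext => x; rewrite patchE /= indicE.
  by case: (_ \in _); rewrite ?mul1r ?mul0r.
have i3 : mu.-integrable setT (EFin \o (fun x => \1_(cbox M) x + \1_(cbox M) x * h x ^+ 2)).
  exact: (integrableD measurableT (integrable_cbox M) i2).
apply: le_integrable i3 => //.
  by apply/measurable_EFinP; apply: measurable_funM => //; exact: measurable_indic.
move=> x _ /=; rewrite lee_fin indicE.
case: (_ \in _) => /=; rewrite ?mul0r ?addr0 ?normr0// !mul1r.
rewrite [leRHS]ger0_norm ?addr_ge0 ?sqr_ge0//.
(* On the box, of finite measure, [|h|] is dominated by 1 + h^2. *)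
have := sqr_ge0 (`|h x| - 1); rewrite -(real_normK (num_real (h x))).
by have := normr_ge0 (h x); set t := `|h x|; nra.
Qed.

Lemma Rintegral_dominated (f_ : nat -> R * R -> R) f g :
  (forall n, measurable_fun setT (f_ n)) -> mu.-integrable setT (EFin \o g) ->
  (forall n x, `|f_ n x| <= g x) -> (forall x, f_ ^~ x @ \oo --> f x) ->
  mu.-integrable setT (EFin \o f) /\ (\int[mu]_x f_ n x) @[n --> \oo] --> \int[mu]_x f x.
Proof.
move=> mf ig fg cf.
have mf' : measurable_fun setT f by apply: (@measurable_fun_cvg _ _ _ setT f_).
have [|||||i1 _ c1] := @dominated_convergence _ _ R mu setT measurableT
  (fun n => EFin \o f_ n) (EFin \o f) (EFin \o g).
- by move=> n; apply/measurable_EFinP; exact: mf.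
- exact/measurable_EFinP.
- by apply: aeW => x _; apply: cvg_EFin; [exact: nearW|exact: cf].
- exact: ig.
- by apply: aeW => x n _; rewrite lee_fin fg.
split=> //; apply: fine_cvg; rewrite fineK//.
exact: integrable_fin_num.
Qed.

End plane_integration.

(** * Partial derivatives along the axes and a C^1 step function *)

Section directional_derivatives.
Context {R : realType}.

Lemma is_derive_cvgP (V W : normedModType R) (f : V -> W) (a v : V) (d : W) :
  is_derive a v f d <-> h^-1 *: (f (h *: v + a) - f a) @[h --> 0^'] --> d.
Proof.
split=> [[df <-]|fd]; first exact: df.
by split; [apply/cvg_ex; exists d|exact/cvg_lim].
Qed.

Lemma is_derive_e1P (f : R * R -> R) (x y d : R) :
  is_derive (x, y) (e1 R) f d <-> is_derive x 1 (fun t => f (t, y)) d.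
Proof.
have E : (fun h => h^-1 *: (f (h *: e1 R + (x, y)) - f (x, y))) =
    (fun h => h^-1 *: ((fun t => f (t, y)) (h *: 1 + x) - f (x, y))).
  apply/funext => h; congr (_ *: (f _ - _)).
  by congr pair => /=; rewrite /GRing.scale/= ?mulr0 ?add0r.
by split=> /is_derive_cvgP fd; apply/is_derive_cvgP; [rewrite -E|rewrite E].
Qed.

Lemma is_derive_e2P (f : R * R -> R) (x y d : R) :
  is_derive (x, y) (e2 R) f d <-> is_derive y 1 (fun t => f (x, t)) d.
Proof.
have E : (fun h => h^-1 *: (f (h *: e2 R + (x, y)) - f (x, y))) =
    (fun h => h^-1 *: ((fun t => f (x, t)) (h *: 1 + y) - f (x, y))).
  apply/funext => h; congr (_ *: (f _ - _)).
  by congr pair => /=; rewrite /GRing.scale/= ?mulr0 ?add0r.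
by split=> /is_derive_cvgP fd; apply/is_derive_cvgP; [rewrite -E|rewrite E].
Qed.

(** At the junction every difference quotient is one of [f] or one of [g], and both families tend to
    the common slope. *)
Lemma is_derive_glue (f g df dg : R -> R) (a t : R) :
  (forall t, is_derive t (1 : R) f (df t)) -> (forall t, is_derive t (1 : R) g (dg t)) ->
  f a = g a -> df a = dg a ->
  is_derive t (1 : R) (fun t => if t <= a then f t else g t) (if t <= a then df t else dg t).
Proof.
move=> hf hg fga dfga; case: (ltgtP t a) => ta.
- apply: (near_eq_is_derive (f := f)) => //.
  by near=> s; rewrite ifT//; near: s; exact: lt_le_nbhsl.
- apply: (near_eq_is_derive (f := g)) => //.
  by near=> s; rewrite leNgt ifF//; apply/negbF; near: s; exact: lt_nbhsr.
- subst t; move: (hf a) (hg a); rewrite -dfga.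
  move=> /is_derive_cvgP/cvgrPdist_le fd /is_derive_cvgP/cvgrPdist_le gd.
  apply/is_derive_cvgP/cvgrPdist_le => e e0.
  have hf' := fd _ e0; have hg' := gd _ e0.
  near=> h; rewrite lexx; case: ifP => _; first by near: h.
  by rewrite fga; near: h.
Unshelve. all: by end_near. Qed.

Definition clamp (t : R) : R := Num.max 0 (Num.min 1 t).

(** The cubic Hermite step: its slope 6 c (1 - c) vanishes at both ends, so clamping keeps it
    C^1. *)
Definition smoothstep t := clamp t ^+ 2 * (3 - 2 * clamp t).

Definition dsmoothstep t := 6 * clamp t * (1 - clamp t).

Lemma clamp_cont : continuous clamp.
Proof.
by move=> t; apply: continuous_max; [exact: cvg_cst|apply: continuous_min; [exact: cvg_cst|exact: cvg_id]].
Qed.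

Lemma dsmoothstep_cont : continuous dsmoothstep.
Proof.
move=> t; apply: cvgM; first by apply: cvgM; [exact: cvg_cst|exact: clamp_cont].
by apply: cvgB; [exact: cvg_cst|exact: clamp_cont].
Qed.

Lemma clampE t : clamp t = if t <= 0 then 0 else if t <= 1 then t else 1.
Proof.
rewrite /clamp; case: (leP t 1) => t1; first by case: (leP t 0).
by rewrite (max_idPr ler01) leNgt (lt_trans ltr01).
Qed.

Lemma clamp_bounds t : 0 <= clamp t <= 1.
Proof. by rewrite clampE; case: (leP t 0); case: (leP t 1); lra. Qed.

Lemma clamp_le0 t : t <= 0 -> clamp t = 0.
Proof. by rewrite clampE; case: (leP t 0); case: (leP t 1); lra. Qed.

Lemma clamp_ge1 t : 1 <= t -> clamp t = 1.
Proof. by rewrite clampE; case: (leP t 0); case: (leP t 1); lra. Qed.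

Lemma smoothstep_bounds t : 0 <= smoothstep t <= 1.
Proof.
have := clamp_bounds t; rewrite /smoothstep; set c := clamp t => /andP[c0 c1].
rewrite mulr_ge0 ?sqr_ge0//=; last lra.
rewrite -subr_ge0 (_ : 1 - _ = (1 - c) ^+ 2 * (1 + 2 * c)); last by ring.
by rewrite mulr_ge0 ?sqr_ge0//; lra.
Qed.

Lemma dsmoothstep_bounds t : 0 <= dsmoothstep t <= 6.
Proof.
have := clamp_bounds t; rewrite /dsmoothstep; set c := clamp t => /andP[c0 c1].
by apply/andP; split; nra.
Qed.

Lemma smoothstep_le0 t : t <= 0 -> smoothstep t = 0.
Proof. by move=> t0; rewrite /smoothstep clamp_le0// expr0n mul0r. Qed.

Lemma smoothstep_ge1 t : 1 <= t -> smoothstep t = 1.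
Proof. by move=> t1; rewrite /smoothstep clamp_ge1//; ring. Qed.

Lemma dsmoothstep_le0 t : t <= 0 -> dsmoothstep t = 0.
Proof. by move=> t0; rewrite /dsmoothstep clamp_le0// mulr0 mul0r. Qed.

Lemma dsmoothstep_ge1 t : 1 <= t -> dsmoothstep t = 0.
Proof. by move=> t1; rewrite /dsmoothstep clamp_ge1// subrr mulr0. Qed.

Lemma is_derive_smoothstep t : is_derive t (1 : R) smoothstep (dsmoothstep t).
Proof.
pose p (u : R) := u ^+ 2 * (3 - 2 * u).
pose dp (u : R) := 6 * u * (1 - u).
have hp u : is_derive u (1 : R) p (dp u).
  by rewrite /p /dp; apply: is_derive_eq; rewrite /GRing.scale/=; ring.
have hc (c u : R) : is_derive u (1 : R) (fun=> c : R) ((fun=> 0) u) by exact: is_derive_cst.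
pose q u := if u <= 1 then p u else 1; pose dq u := if u <= 1 then dp u else 0.
have hq u : is_derive u (1 : R) q (dq u).
  by apply: is_derive_glue => //; rewrite /p /dp; ring.
have : is_derive t (1 : R) (fun u => if u <= 0 then 0 else q u) (if t <= 0 then 0 else dq t).
  apply: (is_derive_glue (df := fun=> 0)) => //; rewrite /q /dq ler01 /p /dp; ring.
rewrite (_ : (fun u => _) = smoothstep).
  congr (is_derive _ _ _ _); rewrite /dsmoothstep clampE /dq /dp.
  by case: (leP t 0); case: (leP t 1); lra.
apply/funext => u; rewrite /smoothstep clampE /q /p.
by case: (leP u 0); case: (leP u 1); lra.
Qed.

End directional_derivatives.

(** * Calculus of C^1 functions on the plane *)

Section C1_functions.
Context {R : realType}.
Implicit Types (f g : R * R -> R) (M : R).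
Local Notation mu := (plane_measure R).

(** The partials are carried as data, so that sums, products and compositions deliver explicit
    formulas; the operator ['D_v] is met only when translating to and from [C1c]. *)
Definition C1d f f1 f2 := [/\ continuous f, continuous f1, continuous f2,
  forall x, is_derive x (e1 R) f (f1 x) & forall x, is_derive x (e2 R) f (f2 x)].

Lemma C1d_eq f f1 f2 g1 g2 : C1d f f1 f2 -> f1 =1 g1 -> f2 =1 g2 -> C1d f g1 g2.
Proof. by move=> + /funext <- /funext <-. Qed.

Lemma C1d_cst (c : R) : C1d (fun=> c) (fun=> 0) (fun=> 0).
Proof. by split=> [||||] x; try exact: cvg_cst; exact: is_derive_cst. Qed.

Lemma C1d_fst : C1d fst (fun=> 1) (fun=> 0).
Proof.
split=> [|x|x|[x y]|[x y]]; try exact: cvg_cst; first by move=> x; exact: cvg_fst.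
  by apply/is_derive_e1P; exact: is_derive_id.
by apply/is_derive_e2P; exact: is_derive_cst.
Qed.

Lemma C1d_snd : C1d snd (fun=> 0) (fun=> 1).
Proof.
split=> [|x|x|[x y]|[x y]]; try exact: cvg_cst; first by move=> x; exact: cvg_snd.
  by apply/is_derive_e1P; exact: is_derive_cst.
by apply/is_derive_e2P; exact: is_derive_id.
Qed.

Lemma C1dD f f1 f2 g g1 g2 : C1d f f1 f2 -> C1d g g1 g2 ->
  C1d (fun x => f x + g x) (fun x => f1 x + g1 x) (fun x => f2 x + g2 x).
Proof.
move=> [cf cf1 cf2 df1 df2] [cg cg1 cg2 dg1 dg2].
split=> x; [exact: cvgD (cf x) (cg x)|exact: cvgD (cf1 x) (cg1 x)
  |exact: cvgD (cf2 x) (cg2 x)|exact: is_deriveD (df1 x) (dg1 x)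
  |exact: is_deriveD (df2 x) (dg2 x)].
Qed.

Lemma C1dM f f1 f2 g g1 g2 : C1d f f1 f2 -> C1d g g1 g2 ->
  C1d (fun x => f x * g x) (fun x => f1 x * g x + f x * g1 x)
    (fun x => f2 x * g x + f x * g2 x).
Proof.
move=> [cf cf1 cf2 df1 df2] [cg cg1 cg2 dg1 dg2].
split=> x.
- exact: cvgM (cf x) (cg x).
- exact: cvgD (cvgM (cf1 x) (cg x)) (cvgM (cf x) (cg1 x)).
- exact: cvgD (cvgM (cf2 x) (cg x)) (cvgM (cf x) (cg2 x)).
- by apply: is_derive_eq (is_deriveM (df1 x) (dg1 x)) _; rewrite /GRing.scale/=; ring.
- by apply: is_derive_eq (is_deriveM (df2 x) (dg2 x)) _; rewrite /GRing.scale/=; ring.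
Qed.

Lemma C1dN f f1 f2 : C1d f f1 f2 ->
  C1d (fun x => - f x) (fun x => - f1 x) (fun x => - f2 x).
Proof.
move=> [cf cf1 cf2 df1 df2].
split=> x; [exact: cvgN (cf x)|exact: cvgN (cf1 x)|exact: cvgN (cf2 x)
  |exact: is_deriveN (df1 x)|exact: is_deriveN (df2 x)].
Qed.

Lemma is_derive_cont (b db : R -> R) : (forall t, is_derive t (1 : R) b (db t)) -> continuous b.
Proof.
move=> hb t; apply: differentiable_continuous; apply/derivable1_diffP.
by case: (hb t).
Qed.

Lemma C1d_comp (b db : R -> R) f f1 f2 : (forall t, is_derive t (1 : R) b (db t)) ->
  continuous db -> C1d f f1 f2 ->
  C1d (fun x => b (f x)) (fun x => db (f x) * f1 x) (fun x => db (f x) * f2 x).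
Proof.
move=> hb cdb [cf cf1 cf2 df1 df2]; have cb := is_derive_cont hb.
have cdbf : continuous (fun x => db (f x)).
  by move=> x; apply: continuous_comp; [exact: cf|exact: cdb].
split=> [x|x|x|[x y]|[x y]].
- by apply: continuous_comp; [exact: cf|exact: cb].
- by apply: cvgM; [exact: cdbf|exact: cf1].
- by apply: cvgM; [exact: cdbf|exact: cf2].
- apply/is_derive_e1P.
  exact: (is_derive1_comp (f := b) (hb _) ((is_derive_e1P _ _ _ _).1 (df1 (x, y)))).
- apply/is_derive_e2P.
  exact: (is_derive1_comp (f := b) (hb _) ((is_derive_e2P _ _ _ _).1 (df2 (x, y)))).
Qed.

(** Meant for functions given by different formulas on different regions, such as a step of [- W]
    restricted to some of the components of {W < 0}. *)
Lemma C1d_local f f1 f2 :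
  (forall x, exists g g1 g2, C1d g g1 g2 /\
     \forall y \near (x : R * R), [/\ f y = g y, f1 y = g1 y & f2 y = g2 y]) -> C1d f f1 f2.
Proof.
move=> H; split=> x; have [g [g1 [g2 [[cg cg1 cg2 dg1 dg2] E]]]] := H x;
  have [E0 E1 E2] := nbhs_singleton E.
- rewrite /continuous_at E0; apply: cvg_trans (cg x); apply: near_eq_cvg.
  by apply: filterS E => y [].
- rewrite /continuous_at E1; apply: cvg_trans (cg1 x); apply: near_eq_cvg.
  by apply: filterS E => y [].
- rewrite /continuous_at E2; apply: cvg_trans (cg2 x); apply: near_eq_cvg.
  by apply: filterS E => y [].
- rewrite E1; apply: near_eq_is_derive (dg1 x); by apply: filterS E => y [].
- rewrite E2; apply: near_eq_is_derive (dg2 x); by apply: filterS E => y [].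
Qed.

Lemma C1d_near0 f f1 f2 (x : R * R) : C1d f f1 f2 -> (\forall y \near x, f y = 0) ->
  f1 x = 0 /\ f2 x = 0.
Proof.
move=> [cf cf1 cf2 df1 df2] f0.
have n0 : \forall y \near x, (fun=> 0) y = f y by apply: filterS f0 => y ->.
split.
- have h0 := near_eq_is_derive n0 (is_derive_cst 0 x (e1 R)).
  by rewrite -(@derive_val _ _ _ _ _ _ _ (df1 x)) (@derive_val _ _ _ _ _ _ _ h0).
- have h0 := near_eq_is_derive n0 (is_derive_cst 0 x (e2 R)).
  by rewrite -(@derive_val _ _ _ _ _ _ _ (df2 x)) (@derive_val _ _ _ _ _ _ _ h0).
Qed.

Lemma C1d_vanishes M f f1 f2 : C1d f f1 f2 -> vanishes_outside M f ->
  vanishes_outside M f1 /\ vanishes_outside M f2.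
Proof.
move=> Cf fM.
have n0 x : M < `|x| -> f1 x = 0 /\ f2 x = 0.
  move=> Mx; apply: (C1d_near0 Cf); near=> y; apply: fM; near: y.
  exact: (@norm_continuous _ _ (x : R * R) [set t | M < t] (lt_nbhsr Mx)).
by split=> x /n0[].
Unshelve. all: by end_near. Qed.

Lemma C1d_C1c M f f1 f2 : C1d f f1 f2 -> vanishes_outside M f ->
  [/\ C1c f, 'D_(e1 R) f = f1 & 'D_(e2 R) f = f2].
Proof.
move=> [cf cf1 cf2 df1 df2] fM.
have E1 : 'D_(e1 R) f = f1 by apply/funext => x; have [] := df1 x.
have E2 : 'D_(e2 R) f = f2 by apply/funext => x; have [] := df2 x.
split=> //; split=> //.
- by split; [move=> x; have [] := df1 x|rewrite E1].
- by split; [move=> x; have [] := df2 x|rewrite E2].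
- by apply/compact_supportP; exists M.
Qed.

Lemma C1c_C1d f : C1c f -> C1d f ('D_(e1 R) f) ('D_(e2 R) f) /\ exists M, vanishes_outside M f.
Proof.
move=> [cf [d1 c1] [d2 c2] /compact_supportP fM]; by split.
Qed.

Lemma integral_deriv_line (F dF : R -> R) M : (forall t, is_derive t (1 : R) F (dF t)) ->
  continuous dF -> (forall t, M < `|t| -> F t = 0) -> (forall t, M < `|t| -> dF t = 0) ->
  (\int[@lebesgue_measure R]_t (dF t)%:E = 0)%E.
Proof.
move=> hF cdF F0 dF0; pose N : R := `|M| + 1.
have N0 : 0 < N by rewrite /N ltr_pwDr.
have MN (t : R) : N <= `|t| -> M < `|t|.
  by apply: lt_le_trans; rewrite /N (le_lt_trans (ler_norm M))// ltrDl.
have -> : (\int[@lebesgue_measure R]_t (dF t)%:E =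
    \int[@lebesgue_measure R]_(t in `[(- N)%R, N]) (dF t)%:E)%E.
  rewrite [RHS]integral_mkcond; apply: eq_integral => t _.
  rewrite patchE; case: ifPn => //; rewrite notin_setE/= in_itv/= -ler_norml => /negP.
  by rewrite -ltNge => /ltW/MN/dF0 ->.
have cF := is_derive_cont hF.
have FN : F N = 0 by apply/F0/MN; rewrite gtr0_norm.
have FNN : F (- N) = 0 by apply/F0/MN; rewrite normrN gtr0_norm.
rewrite (@continuous_FTC2 _ dF F); first by rewrite FN FNN subee.
- by rewrite gtrN.
- exact: continuous_subspaceT.
- split=> [t _||]; first by have [] := hF t.
  + exact: cvg_at_right_filter (cF _).
  + exact: cvg_at_left_filter (cF _).
- by move=> t _; rewrite derive1E; have [] := hF t.
Qed.

(** Fubini, with the inner integral taken along the direction of differentiation, where the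
    fundamental theorem of calculus gives 0. *)
Lemma integral_partial M f f1 f2 : C1d f f1 f2 -> vanishes_outside M f ->
  \int[mu]_x f1 x = 0 /\ \int[mu]_x f2 x = 0.
Proof.
move=> Cf fM; have [f1M f2M] := C1d_vanishes Cf fM.
have [cf cf1 cf2 df1 df2] := Cf.
have sl1 (x y : R) : M < `|x| -> M < `|(x, y)|.
  by rewrite prod_normE lt_max => ->.
have sl2 (x y : R) : M < `|y| -> M < `|(x, y)|.
  by rewrite prod_normE lt_max orbC => ->.
split; rewrite /Rintegral.
- have i1 := integrable_locbounded (locbounded_cont cf1) f1M.
  rewrite -integral21_prod_meas1//= integral0_eq// => y _.
  apply: (@integral_deriv_line (fun x => f (x, y)) (fun x => f1 (x, y)) M).
  + by move=> t; apply/is_derive_e1P.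
  + by move=> t; apply: (@continuous_comp R (R * R)%type R (fun x : R => (x, y)) f1);
      [exact: (cvg_pair cvg_id (cvg_cst _))|exact: cf1].
  + by move=> t /(sl1 _ y)/fM.
  + by move=> t /(sl1 _ y)/f1M.
- have i2 := integrable_locbounded (locbounded_cont cf2) f2M.
  rewrite -integral12_prod_meas1//= integral0_eq// => x _.
  apply: (@integral_deriv_line (fun y => f (x, y)) (fun y => f2 (x, y)) M).
  + by move=> t; apply/is_derive_e2P.
  + by move=> t; apply: (@continuous_comp R (R * R)%type R (fun y : R => (x, y)) f2);
      [exact: (cvg_pair (cvg_cst _) cvg_id)|exact: cf2].
  + by move=> t /(sl2 x)/fM.
  + by move=> t /(sl2 x)/f2M.
Qed.

End C1_functions.

(** * Vanishing of weakly null functions *)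

Section step_sequences.
Context {R : realType}.
Implicit Types (t a b : R) (n : nat).

(** A C^1 approximation of the indicator of t > 0: it is 0 for n t <= 1 and 1 for n t >= 2, so near
    each fixed t the value is eventually constant. *)
Definition stepn n t : R := smoothstep (n%:R * t - 1).

Definition dstepn n t : R := n%:R * dsmoothstep (n%:R * t - 1).

Lemma is_derive_stepn n t : is_derive t (1 : R) (stepn n) (dstepn n t).
Proof.
have h : is_derive t (1 : R) (fun s => n%:R * s - 1) n%:R.
  by apply: is_derive_eq; rewrite /GRing.scale/=; ring.
apply: is_derive_eq (is_derive1_comp (is_derive_smoothstep _) h) _.
by rewrite mulrC.
Qed.

Lemma dstepn_cont n : continuous (dstepn n).
Proof.
move=> t; apply: cvgM; first exact: cvg_cst.
apply: (@continuous_comp R R R (fun t => n%:R * t - 1) dsmoothstep); last exact: dsmoothstep_cont.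
by apply: cvgB; [apply: cvgM; [exact: cvg_cst|exact: cvg_id]|exact: cvg_cst].
Qed.

Lemma stepn_bounds n t : 0 <= stepn n t <= 1.
Proof. exact: smoothstep_bounds. Qed.

Lemma stepn_small n t : n%:R * t <= 1 -> stepn n t = 0.
Proof. by move=> h; apply: smoothstep_le0; rewrite subr_le0. Qed.

Lemma dstepn_small n t : n%:R * t <= 1 -> dstepn n t = 0.
Proof. by move=> h; rewrite /dstepn dsmoothstep_le0 ?mulr0// subr_le0. Qed.

Lemma dstepn_ge0 n t : 0 <= dstepn n t.
Proof. by rewrite /dstepn mulr_ge0//; have /andP[] := dsmoothstep_bounds (n%:R * t - 1). Qed.

Lemma near_natmul_ge2 t : 0 < t -> \forall n \near \oo, 2 <= n%:R * t.
Proof.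
move=> t0; near=> n; rewrite -ler_pdivrMr//; near: n; exact: nbhs_infty_ger.
Unshelve. all: by end_near. Qed.

Lemma natmul_le0 n t : t <= 0 -> n%:R * t <= 1.
Proof. by move=> t0; rewrite (le_trans _ ler01)// mulr_ge0_le0. Qed.

Lemma stepn_cvg t : stepn n t @[n --> \oo] --> ((0 < t)%R%:R : R).
Proof.
case: ltP => t0; apply: cvg_near_cst; last first.
  by apply: nearW => n; rewrite stepn_small// natmul_le0.
by near=> n; rewrite /stepn smoothstep_ge1// lerBrDr; near: n; exact: near_natmul_ge2.
Unshelve. all: by end_near. Qed.

Lemma mul_dstepn_cvg t : t * dstepn n t @[n --> \oo] --> (0 : R).
Proof.
case: (ltP 0 t) => t0; apply: cvg_near_cst; last first.
  by apply: nearW => n; rewrite dstepn_small ?mulr0// natmul_le0.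
near=> n; rewrite /dstepn dsmoothstep_ge1 ?mulr0// lerBrDr.
by near: n; exact: near_natmul_ge2.
Unshelve. all: by end_near. Qed.

(** With s = n t the product is s times [dsmoothstep (s - 1)], which lives on 1 < s < 2; hence 2 * 6
    = 12. The bound is uniform in n although [dstepn n] itself grows like n, and this is what allows
    dominated convergence near the nodal set. *)
Lemma mul_dstepn_bound n t : `|t * dstepn n t| <= 12.
Proof.
rewrite /dstepn mulrCA; set s := n%:R * t; rewrite mulrA -/s.
have /andP[d0 d6] := dsmoothstep_bounds (s - 1).
have [s1|s1] := leP s 1; first by rewrite dsmoothstep_le0 ?mulr0 ?normr0// subr_le0.
have [s2|s2] := leP 2 s; first by rewrite dsmoothstep_ge1 ?mulr0 ?normr0// lerBrDr.
by rewrite ger0_norm; nra.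
Qed.

(** Sets whose indicator is a bounded pointwise limit of C^1 functions vanishing off the set.
    Half-lines qualify, and they generate the Borel sets. *)
Definition C1_approximable (I : set R) := exists b db : nat -> R -> R,
  [/\ forall n t, is_derive t (1 : R) (b n) (db n t), forall n, continuous (db n),
    forall n t, 0 <= b n t <= 1, forall n t, ~ I t -> b n t = 0 &
    forall t, b n t @[n --> \oo] --> (\1_I t : R)].

Lemma C1_approximable_setT : C1_approximable setT.
Proof.
exists (fun _ _ => 1), (fun _ _ => 0); split=> [n t|n|n t|n t|t].
- exact: is_derive_cst.
- by move=> t; exact: cvg_cst.
- by rewrite ler01 lexx.
- by case.
- by rewrite indicE in_setT; exact: cvg_cst.
Qed.

Lemma C1_approximable_setI I J : C1_approximable I -> C1_approximable J ->
  C1_approximable (I `&` J).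
Proof.
move=> [b [db [hb cb bb b0 lb]]] [c [dc [hc cc bc c0 lc]]].
exists (fun n t => b n t * c n t), (fun n t => db n t * c n t + b n t * dc n t).
split=> [n t|n t|n t|n t|t].
- by apply: is_derive_eq (is_deriveM (hb n t) (hc n t)) _; rewrite /GRing.scale/=; ring.
- apply: cvgD; apply: cvgM.
  + exact: cb. + exact: (is_derive_cont (hc n)).
  + exact: (is_derive_cont (hb n)). + exact: cc.
- have /andP[? ?] := bb n t; have /andP[? ?] := bc n t.
  by rewrite mulr_ge0//= mulr_ile1.
- by move=> /not_andP[/b0|/c0] ->; rewrite ?mul0r ?mulr0.
- by rewrite indicI; exact: cvgM (lb t) (lc t).
Qed.

Lemma C1_approximable_gt a : C1_approximable `]a, +oo[.
Proof.
have hd t : is_derive t (1 : R) (fun t => t - a) 1.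
  by apply: is_derive_eq; rewrite ?subr0 ?addr0.
exists (fun n t => stepn n (t - a)), (fun n t => dstepn n (t - a)); split=> [n t|n t|n t|n t|t].
- by apply: is_derive_eq (is_derive1_comp (is_derive_stepn _ _) (hd t)) _; rewrite mulr1.
- apply: (@continuous_comp R R R (fun t => t - a) (dstepn n)); last exact: dstepn_cont.
  by apply: cvgB; [exact: cvg_id|exact: cvg_cst].
- exact: stepn_bounds.
- move=> /negP; rewrite in_itv/= andbT -leNgt -subr_le0 => h.
  by rewrite stepn_small// natmul_le0.
- rewrite indicE (_ : (t \in _) = (0 < t - a)); first exact: stepn_cvg.
  by apply/idP/idP; rewrite inE/= in_itv/= andbT subr_gt0.
Qed.

Lemma C1_approximable_lt a : C1_approximable `]-oo, a[.
Proof.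
have hd t : is_derive t (1 : R) (fun t => a - t) (- 1).
  by apply: is_derive_eq; rewrite ?sub0r ?add0r ?mul1r.
exists (fun n t => stepn n (a - t)), (fun n t => - dstepn n (a - t)); split=> [n t|n t|n t|n t|t].
- by apply: is_derive_eq (is_derive1_comp (is_derive_stepn _ _) (hd t)) _; rewrite mulrN1.
- apply: cvgN; apply: (@continuous_comp R R R (fun t => a - t) (dstepn n)); last exact: dstepn_cont.
  by apply: cvgB; [exact: cvg_cst|exact: cvg_id].
- exact: stepn_bounds.
- move=> /negP; rewrite in_itv/= -leNgt -subr_le0 => h.
  by rewrite stepn_small// natmul_le0.
- rewrite indicE (_ : (t \in _) = (0 < a - t)); first exact: stepn_cvg.
  by apply/idP/idP; rewrite inE/= in_itv/= subr_gt0.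
Qed.

Lemma C1_approximable_oo a b : C1_approximable `]a, b[.
Proof.
rewrite (_ : [set` _] = `]a, +oo[ `&` `]-oo, b[).
  by apply: C1_approximable_setI; [exact: C1_approximable_gt|exact: C1_approximable_lt].
apply/seteqP; split=> t /=; rewrite !in_itv/= !andbT; first by move/andP.
by move=> [-> ->].
Qed.

End step_sequences.

(** * The fundamental lemma of the calculus of variations *)

Section fundamental_lemma.
Context {R : realType}.
Implicit Types (h : R * R -> R).
Local Notation mu := (plane_measure R).

Lemma ae_imply (P Q : R * R -> Prop) : (forall x, P x -> Q x) ->
  {ae mu, forall x, P x} -> {ae mu, forall x, Q x}.
Proof.
move=> PQ [N [mN N0 HN]]; exists N; split=> // x /= nQ.
by apply: HN => /= /PQ.
Qed.

(** Dynkin's pi-lambda theorem, three times: it frees the first side of the rectangle, then the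
    second, then passes from measurable rectangles to the whole product sigma-algebra. Open
    half-lines serve as the generating pi-system on each axis. *)
Lemma ae_eq0_rectangles (H : R * R -> R) : mu.-integrable setT (EFin \o H) ->
  (forall I J, C1_approximable I -> C1_approximable J ->
    (\int[mu]_(x in I `*` J) (H x)%:E = 0)%E) ->
  {ae mu, forall x, H x = 0}.
Proof.
move=> iH H0.
have mH : measurable_fun setT (EFin \o H) by exact: measurable_int iH.
pose P (S : set (R * R)) := (\int[mu]_(x in S) (H x)%:E = 0)%E.
have PD S T : measurable S -> measurable T -> S `<=` T -> P S -> P T -> P (T `\` S).
  move=> mS mT ST PS; rewrite /P -{1}(setDUK ST).
  rewrite integral_setU_EFin//.
  - by rewrite [X in (X + _)%E]PS add0e.
  - exact: measurableD.
  - by apply/measurable_EFinP; exact: measurable_funTS.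
  - by apply/disj_setPS => x [? []].
have PU (F : (set (R * R))^nat) : (forall n, measurable (F n)) -> trivIset setT F ->
    (forall n, P (F n)) -> P (\bigcup_n F n).
  move=> mF tF PF; rewrite /P (@integral_bigcup _ _ R mu F (EFin \o H) tF)//.
  - by apply: eseries0 => i _ _; exact: PF.
  - by apply: (integrableS measurableT) iH => //; exact: bigcupT_measurable.
pose G := @RGenOInfty.G R.
have mG : (measurable : set (set R)) = <<s G >> by exact: RGenOInfty.measurableE.
have GI : setI_closed G.
  move=> _ _ [x ->] [y ->]; exists (Num.max x y).
  by apply/seteqP; split=> t /=; rewrite !in_itv/= !andbT gt_max => /andP.
have P1 J A : C1_approximable J -> measurable J -> measurable A -> P (A `*` J).
  move=> aJ mJ mA; have sA : <<s G >> A by rewrite -mG.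
  move: A {mA} sA; apply: (@dynkin_induction _ _ G (fun A => P (A `*` J)) mG GI).
  - by apply: H0 => //; exact: C1_approximable_setT.
  - by move=> _ [x ->]; apply: H0 => //; exact: C1_approximable_gt.
  - move=> S mS PS; rewrite (_ : _ `*` _ = (setT `*` J) `\` (S `*` J)).
      apply: PD PS _; [exact: measurableX|exact: measurableX|by move=> x []|].
      by apply: H0 => //; exact: C1_approximable_setT.
    by apply/seteqP; split=> x /=; tauto.
  - move=> F mF /trivIsetP tF PF; rewrite (_ : _ `*` _ = \bigcup_n (F n `*` J)); last first.
      apply/seteqP; split=> x; first by move=> [[n _ Fx] Jx]; exists n.
      by move=> [n _ [Fx Jx]]; split=> //; exists n.
    apply: PU => //; first by move=> n; exact: measurableX.
    by apply/trivIsetP => i j _ _ ij; rewrite -setXI (tF i j)// set0X.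
have P2 A B : measurable A -> measurable B -> P (A `*` B).
  move=> mA mB; have sB : <<s G >> B by rewrite -mG.
  move: B {mB} sB; apply: (@dynkin_induction _ _ G (fun B => P (A `*` B)) mG GI).
  - by apply: P1 => //; exact: C1_approximable_setT.
  - by move=> _ [x ->]; apply: P1 => //; exact: C1_approximable_gt.
  - move=> S mS PS; rewrite (_ : _ `*` _ = (A `*` setT) `\` (A `*` S)).
      apply: PD PS _; [exact: measurableX|exact: measurableX|by move=> x []|].
      by apply: P1 => //; exact: C1_approximable_setT.
    by apply/seteqP; split=> x /=; tauto.
  - move=> F mF /trivIsetP tF PF; rewrite (_ : _ `*` _ = \bigcup_n (A `*` F n)); last first.
      apply/seteqP; split=> x; first by move=> [Ax [n _ Fx]]; exists n.
      by move=> [n _ [Ax Fx]]; split=> //; exists n.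
    apply: PU => //; first by move=> n; exact: measurableX.
    by apply/trivIsetP => i j _ _ ij; rewrite -setXI (tF i j)// setX0.
have PS S : measurable S -> P S.
  rewrite measurable_prod_measurableType.
  apply: (dynkin_induction (measurable_prod_measurableType _ _)).
  - move=> _ _ [A mA [B mB <-]] [A' mA' [B' mB' <-]]; rewrite -setXI.
    by exists (A `&` A'); [exact: measurableI|exists (B `&` B') => //; exact: measurableI].
  - by rewrite -setXTT; exact: P2.
  - by move=> _ [A mA [B mB <-]]; exact: P2.
  - by move=> S' mS' PS'; rewrite -setTD; apply: PD => //; rewrite -setXTT; exact: P2.
  - exact: PU.
(* The integrals of [H] over {H >= 0} and over its complement both vanish, so the integral of its
   absolute value is 0. *)
have [N [mN N0 HN]] : ae_eq mu setT (EFin \o H) (cst 0).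
  apply/(ae_eq_integral_abs mu measurableT mH).
  pose S := H @^-1` `[0, +oo[.
  have mS : measurable S.
    by rewrite -[S]setTI; apply: (measurable_EFinP _ _).1 mH _ _ _ => //; exact: measurable_itv.
  have iC : mu.-integrable (~` S) (EFin \o H).
    by apply: (integrableS measurableT) iH => //; exact: measurableC.
  rewrite -(setUv S) ge0_integral_setU//=.
  - rewrite (_ : (\int[mu]_(x in S) _)%E = 0%E); last first.
      rewrite -[RHS](PS _ mS); apply: eq_integral => x; rewrite inE /S/= in_itv/= andbT => Hx.
      by rewrite ger0_norm.
    rewrite add0e -[RHS](mule0 (-1)%:E) -[in RHS](PS _ (measurableC mS)).
    rewrite -(@integralZl _ _ R mu (~` S) _ _ iC); last exact: measurableC.
    apply: eq_integral => x; rewrite inE /S/= in_itv/= andbT => /negP; rewrite -ltNge => Hx.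
    by rewrite ltr0_norm//= -EFinM mulN1r.
  - exact: measurableC.
  - by rewrite setUv; apply/measurable_EFinP; apply: measurableT_comp => //; exact/measurable_EFinP.
  - by apply/disj_setPS => x [].
exists N; split=> // x /= Hx; apply: HN => /= /(_ I) [E]; exact: Hx.
Qed.

(** The products [p n x.1 * q n x.2] are admissible tests supported in the open rectangle and tend
    to the indicator of its intersection with [I] times [J]; dominated convergence transfers the
    vanishing to rectangles. Multiplying by [\1_Q] makes the merely locally integrable [h]
    integrable. *)
Lemma weak_zero (a b c d : R) h : L2loc h ->
  (forall psi psi1 psi2, C1d psi psi1 psi2 ->
    (forall x, ~ (`]a, b[ `*` `]c, d[) x -> psi x = 0) ->
    \int[mu]_x (h x * psi x) = 0) ->
  {ae mu, forall x, (`]a, b[ `*` `]c, d[) x -> h x = 0}.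
Proof.
move=> Lh h0; set Q := `]a, b[ `*` `]c, d[.
pose M : R := `|a| + `|b| + `|c| + `|d|.
have mQ : measurable Q by apply: measurableX; exact: measurable_itv.
have QM x : Q x -> cbox M x.
  move=> [/=]; rewrite !in_itv/= => /andP[x1 x2] /andP[x3 x4]; apply/cboxE.
  have := ler_norm a; have := ler_norm b; have := ler_norm c; have := ler_norm d.
  have := ler_norm (- a); have := ler_norm (- b); have := ler_norm (- c); have := ler_norm (- d).
  rewrite !normrN prod_normE /M ge_max !ler_norml.
  move: `|a| `|b| `|c| `|d| => ? ? ? ? *; apply/andP; split; apply/andP; split; lra.
have mh : measurable_fun setT h by case: Lh.
have iH : mu.-integrable setT (EFin \o (fun x => \1_Q x * h x)).
  apply: le_integrable (L2loc_cbox M Lh) => //.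
    by apply/measurable_EFinP; apply: measurable_funM => //; exact: measurable_indic.
  move=> x _ /=; rewrite lee_fin !indicE; case: (boolP (x \in Q)) => [|_] /=.
    by rewrite inE => /QM Mx; rewrite mem_set.
  by rewrite mul0r normr0.
suff : {ae mu, forall x, \1_Q x * h x = 0}.
  by apply: ae_imply => x; rewrite indicE => + Qx; rewrite mem_set// mul1r.
apply: ae_eq0_rectangles => // I J aI aJ.
have [p [dp [hp cp bp p0 lp]]] := C1_approximable_setI aI (C1_approximable_oo a b).
have [q [dq [hq cq bq q0 lq]]] := C1_approximable_setI aJ (C1_approximable_oo c d).
pose F x := h x * (\1_(I `&` `]a, b[) x.1 * \1_(J `&` `]c, d[) x.2).
have cpq n : continuous (fun x => p n x.1 * q n x.2).
  have [cc _ _ _ _] := C1dM (C1d_comp (hp n) (cp n) C1d_fst) (C1d_comp (hq n) (cq n) C1d_snd).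
  exact: cc.
have [iF cF] : mu.-integrable setT (EFin \o F) /\
    (\int[mu]_x (h x * (p n x.1 * q n x.2))) @[n --> \oo] --> \int[mu]_x F x.
  apply: (Rintegral_dominated (g := fun x => `|\1_Q x * h x|)).
  - by move=> n; apply: measurable_funM => //; exact: continuous_measurable_plane.
  - exact: (integrable_abse iH).
  - move=> n [x y]; have /andP[? ?] := bp n x; have /andP[? ?] := bq n y.
    rewrite !normrM mulrC indicE /=; case: (boolP ((x, y) \in Q)) => [_|].
      by rewrite normr1 ler_wpM2r// -normrM ger0_norm ?mulr_ge0// mulr_ile1.
    rewrite notin_setE => /not_andP[] /= xQ.
      by rewrite p0 ?normr0 ?mul0r// => -[].
    by rewrite q0 ?normr0 ?mul0r ?mulr0 ?mul0r// => -[].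
  - by move=> x; apply: cvgM; [exact: cvg_cst|apply: cvgM; [exact: lp|exact: lq]].
have F0 : \int[mu]_x F x = 0.
  apply: (cvg_unique _ cF); first exact: norm_hausdorff.
  rewrite (_ : (fun n => _) = fun=> 0); first exact: cvg_cst.
  apply/funext => n.
  apply: h0 (C1dM (C1d_comp (hp n) (cp n) C1d_fst) (C1d_comp (hq n) (cq n) C1d_snd)) _ => x.
  by move=> /not_andP[] xQ; [rewrite p0 ?mul0r// => -[]|rewrite q0 ?mulr0// => -[]].
rewrite integral_mkcond -[RHS](congr1 EFin F0) /Rintegral fineK; last exact: integrable_fin_num.
apply: eq_integral => x _; rewrite patchE /F !indicE.
have mX A B : (x \in A `*` B) = (x.1 \in A) && (x.2 \in B).
  by apply/idP/andP; rewrite !inE => -[].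
rewrite !mX !in_setI.
by case: (x.1 \in I); case: (x.2 \in J); case: (x.1 \in _); case: (x.2 \in _);
  rewrite /= ?mul1r ?mul0r ?mulr0 ?mulr1.
Qed.

End fundamental_lemma.

(** * From Lipschitz test functions to truncated gradients *)

Section test_functions.
Context {R : realType}.
Implicit Types (f g phi : R * R -> R) (h k : R * R -> R * R) (M : R).
Local Notation mu := (plane_measure R).

Lemma lipschitz_cont phi : lipschitz phi -> continuous phi.
Proof.
move=> /pinfty_ex_gt0 [K K0 lK] x; apply/cvgrPdist_le => e e0.
near=> y; rewrite (le_trans (lK (x, y) _))//= -ler_pdivlMl// mulrC.
by near: y; apply: cvgr_dist_le => //; rewrite divr_gt0.
Unshelve. all: by end_near. Qed.

Definition bump M t : R := smoothstep (M + 1 - t) * smoothstep (M + 1 + t).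

Lemma cutoff_exists M : exists c c1 c2, [/\ C1d c c1 c2, vanishes_outside (M + 1) c,
  forall x, `|x| <= M -> c x = 1 & forall x, `|x| <= M -> c1 x = 0 /\ c2 x = 0].
Proof.
pose dbump t := - dsmoothstep (M + 1 - t) * smoothstep (M + 1 + t) +
  smoothstep (M + 1 - t) * dsmoothstep (M + 1 + t).
have da t : is_derive t (1 : R) (fun s => M + 1 - s) (- 1).
  by apply: is_derive_eq; rewrite ?sub0r ?add0r ?mul1r.
have db t : is_derive t (1 : R) (fun s => M + 1 + s) 1.
  by apply: is_derive_eq; rewrite ?sub0r ?add0r ?mul1r.
have hb t : is_derive t (1 : R) (bump M) (dbump t).
  apply: is_derive_eq (is_deriveM (is_derive1_comp (is_derive_smoothstep _) (da t))
    (is_derive1_comp (is_derive_smoothstep _) (db t))) _.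
  by rewrite /dbump /GRing.scale/=; ring.
have c_sub : continuous (fun t : R => M + 1 - t) := is_derive_cont da.
have c_add : continuous (fun t : R => M + 1 + t) := is_derive_cont db.
have cdb : continuous dbump.
  have c_comp (b l : R -> R) : continuous b -> continuous l -> continuous (fun t => b (l t)).
    by move=> cb cl t; apply: (@continuous_comp R R R l b); [exact: cl|exact: cb].
  have cs : continuous (@smoothstep R) := is_derive_cont is_derive_smoothstep.
  have cd := @dsmoothstep_cont R.
  move=> t; apply: cvgD; apply: cvgM.
  - by apply: cvgN; exact: (c_comp _ _ cd c_sub).
  - exact: (c_comp _ _ cs c_add).
  - exact: (c_comp _ _ cs c_sub).
  - exact: (c_comp _ _ cd c_add).
have bump0 t : M + 1 < `|t| -> bump M t = 0.
  rewrite ltNge ler_norml negb_and -!ltNge => /orP[] h; rewrite /bump.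
    by rewrite [X in _ * X]smoothstep_le0 ?mulr0//; lra.
  by rewrite smoothstep_le0 ?mul0r//; lra.
have bump1 t : `|t| <= M -> bump M t = 1 /\ dbump t = 0.
  rewrite ler_norml => /andP[h1 h2]; rewrite /bump /dbump.
  have s1 : 1 <= M + 1 - t by lra.
  have s2 : 1 <= M + 1 + t by lra.
  by rewrite !smoothstep_ge1// !dsmoothstep_ge1//; split; ring.
exists (fun x => bump M x.1 * bump M x.2); do 2 eexists; split.
- exact: C1dM (C1d_comp hb cdb C1d_fst) (C1d_comp hb cdb C1d_snd).
- move=> x; rewrite prod_normE lt_max => /orP[] /bump0 ->; by rewrite ?mul0r ?mulr0.
- move=> x; rewrite prod_normE ge_max => /andP[/bump1[-> _] /bump1[-> _]].
  by rewrite mulr1.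
- move=> x; rewrite prod_normE ge_max => /andP[/bump1[-> ->] /bump1[-> ->]].
  by split; ring.
Qed.

(* [k] plays the role of [h] in [weak_gradient phi h], truncated to a box: since
   [h] vanishes a.e. off the support of [phi], the integrations by parts remain
   valid, and now against arbitrary C^1 functions. *)
Definition test_pair M phi k := [/\ locbounded phi, vanishes_outside M phi,
  forall x, 0 <= phi x,
  [/\ vanishes_outside M (fst \o k), vanishes_outside M (snd \o k),
      mu.-integrable setT (EFin \o (fst \o k)) & mu.-integrable setT (EFin \o (snd \o k))]
  & forall f f1 f2, C1d f f1 f2 ->
      (\int[mu]_x (phi x * f1 x) = - \int[mu]_x ((k x).1 * f x)) /\
      (\int[mu]_x (phi x * f2 x) = - \int[mu]_x ((k x).2 * f x))].

Lemma ae_conj (P Q : R * R -> Prop) : {ae mu, forall x, P x} -> {ae mu, forall x, Q x} ->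
  {ae mu, forall x, P x /\ Q x}.
Proof.
move=> [N1 [mN1 N10 H1]] [N2 [mN2 N20 H2]]; exists (N1 `|` N2); split.
- exact: measurableU.
- by rewrite null_set_setU.
- by move=> x /= /not_andP[Px|Qx]; [left; exact: H1|right; exact: H2].
Qed.

Lemma ae_zero_outside M hi : L2loc hi ->
  (forall psi psi1 psi2, C1d psi psi1 psi2 -> (exists N, vanishes_outside N psi) ->
    (forall x, `|x| <= M -> psi x = 0) -> \int[mu]_x (hi x * psi x) = 0) ->
  {ae mu, forall x, M < `|x| -> hi x = 0}.
Proof.
move=> Lh h0.
have box (a b c d : R) : (forall x, (`]a, b[ `*` `]c, d[) x -> M < `|x|) ->
    {ae mu, forall x, (`]a, b[ `*` `]c, d[) x -> hi x = 0}.
  move=> QM; apply: weak_zero => // psi psi1 psi2 Cpsi psi0.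
  apply: h0 Cpsi _ _.
    exists (`|a| + `|b| + `|c| + `|d|) => x xN; apply: psi0 => -[/=].
    rewrite !in_itv/= => /andP[x1 x2] /andP[x3 x4]; move: xN; apply/negP; rewrite -leNgt.
    have := ler_norm a; have := ler_norm b; have := ler_norm c; have := ler_norm d.
    have := ler_norm (- a); have := ler_norm (- b); have := ler_norm (- c).
    have := ler_norm (- d).
    rewrite !normrN prod_normE ge_max !ler_norml.
    by move: `|a| `|b| `|c| `|d| => ? ? ? ? *; apply/andP; split; apply/andP; split; lra.
  by move=> x xM; apply: psi0 => /QM; rewrite ltNge xM.
(* The complement of the box is the union of four half-planes. Each is exhausted, as n grows, by
   bounded rectangles, the only sets that [weak_zero] treats. *)
have a1 n : {ae mu, forall x, (`]M, n%:R[ `*` `]- n%:R, n%:R[) x -> hi x = 0}.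
  by apply: box => x [/=]; rewrite !in_itv/= prod_normE lt_max lter_normr => /andP[-> _].
have a2 n : {ae mu, forall x, (`]- n%:R, - M[ `*` `]- n%:R, n%:R[) x -> hi x = 0}.
  apply: box => x [/=]; rewrite !in_itv/= prod_normE lt_max lter_normr => /andP[_ h] _.
  by rewrite [X in _ || X || _]ltrNr h orbT.
have a3 n : {ae mu, forall x, (`]- n%:R, n%:R[ `*` `]M, n%:R[) x -> hi x = 0}.
  apply: box => x [/=]; rewrite !in_itv/= prod_normE lt_max => _ /andP[h _].
  by rewrite [X in _ || X]lter_normr h orbT.
have a4 n : {ae mu, forall x, (`]- n%:R, n%:R[ `*` `]- n%:R, - M[) x -> hi x = 0}.
  apply: box => x [/=]; rewrite !in_itv/= prod_normE lt_max => _ /andP[_ h].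
  by rewrite [X in _ || X]lter_normr [X in _ || (_ || X)]ltrNr h !orbT.
have := ae_conj (ae_conj (ae_foralln a1) (ae_foralln a2)) (ae_conj (ae_foralln a3) (ae_foralln a4)).
apply: ae_imply => -[x y] /= [[h1 h2] [h3 h4]] Mx.
have [n nx] : exists n : nat, `|x| < n%:R /\ `|y| < n%:R.
  exists (Num.truncn (`|x| + `|y|)).+1; have := truncnS_gt (`|x| + `|y|).
  by have := normr_ge0 x; have := normr_ge0 y; lra.
move: nx; rewrite !ltr_norml => -[/andP[x1 x2] /andP[y1 y2]].
move: Mx; rewrite prod_normE lt_max !lter_normr /= => /orP[/orP[]|/orP[]] Mx.
- by apply: (h1 n); rewrite /= !in_itv/= Mx x2 y1 y2.
- by apply: (h2 n); rewrite /= !in_itv/= x1 y1 y2 ltrNr Mx.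
- by apply: (h3 n); rewrite /= !in_itv/= Mx x1 x2 y2.
- by apply: (h4 n); rewrite /= !in_itv/= x1 x2 y1 ltrNr Mx.
Qed.

Lemma Rintegral_ae f g : measurable_fun setT f -> measurable_fun setT g ->
  {ae mu, forall x, f x = g x} -> \int[mu]_x f x = \int[mu]_x g x.
Proof.
move=> mf mg fg; congr fine; apply: ae_eq_integral => //; try exact/measurable_EFinP.
by apply: ae_imply fg => x -> _.
Qed.

Lemma weak_derivative1P f g : weak_derivative (e1 R) f g <->
  forall psi psi1 psi2 M, C1d psi psi1 psi2 -> vanishes_outside M psi ->
    \int[mu]_x (f x * psi1 x) = - \int[mu]_x (g x * psi x).
Proof.
split=> [w psi psi1 psi2 M Cpsi psiM|w psi /C1c_C1d[Cpsi [M psiM]]]; last exact: w Cpsi psiM.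
have [C1 E1 _] := C1d_C1c Cpsi psiM; rewrite -(w _ C1).
by apply: eq_Rintegral => x _; rewrite -E1.
Qed.

Lemma weak_derivative2P f g : weak_derivative (e2 R) f g <->
  forall psi psi1 psi2 M, C1d psi psi1 psi2 -> vanishes_outside M psi ->
    \int[mu]_x (f x * psi2 x) = - \int[mu]_x (g x * psi x).
Proof.
split=> [w psi psi1 psi2 M Cpsi psiM|w psi /C1c_C1d[Cpsi [M psiM]]]; last exact: w Cpsi psiM.
have [C1 _ E2] := C1d_C1c Cpsi psiM; rewrite -(w _ C1).
by apply: eq_Rintegral => x _; rewrite -E2.
Qed.

Lemma locbounded_perp (g : R * R -> R * R) : locbounded (fst \o g) -> locbounded (snd \o g) ->
  locbounded (fun x => dot2 (perp x) (g x)).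
Proof.
move=> g1 g2; have [[c1 _ _ _ _] [c2 _ _ _ _]] := (@C1d_fst R, @C1d_snd R).
exact: (locboundedD (locboundedM (locboundedN (locbounded_cont c2)) g1)
  (locboundedM (locbounded_cont c1) g2)).
Qed.

Lemma test_pair_exists phi h : admissible_test phi -> weak_gradient phi h ->
  exists M k, test_pair M phi k /\
    forall (om : R) (g : R * R -> R * R), locbounded (fst \o g) -> locbounded (snd \o g) ->
      rotating_form om g phi h = rotating_form om g phi k.
Proof.
move=> [/lipschitz_cont cphi /compact_supportP[M0 phi0] phi_ge0] [L1 L2 /weak_derivative1P w1 /weak_derivative2P w2].
(* The margin of 1 puts the points with [|x| <= M0] inside the region where [psi] vanishes, so that
   the partials of [psi] vanish there as well. *)
pose M := M0 + 1.
have near0 psi psi1 psi2 : C1d psi psi1 psi2 -> (forall x, `|x| <= M -> psi x = 0) ->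
    forall x, phi x * psi1 x = 0 /\ phi x * psi2 x = 0.
  move=> Cpsi psi0 x; have [xM|Mx] := leP `|x| M0; last by rewrite phi0// !mul0r.
  suff [-> ->] : psi1 x = 0 /\ psi2 x = 0 by rewrite !mulr0.
  apply: (C1d_near0 Cpsi); near=> y; apply/psi0/ltW; near: y.
  have xM' : `|x| < M by rewrite /M ltr_pwDr.
  exact: (@norm_continuous _ _ (x : R * R) [set t | t < M] (lt_nbhsl xM')).
have h1 : {ae mu, forall x, M < `|x| -> (h x).1 = 0}.
  apply: (@ae_zero_outside M (fst \o h)) => // psi psi1 psi2 Cpsi [N psiN] psi0.
  have := w1 _ _ _ _ Cpsi psiN => /esym/eqP; rewrite eqr_oppLR => /eqP ->.
  under eq_Rintegral => x _ do rewrite (near0 _ _ _ Cpsi psi0 x).1.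
  by rewrite Rintegral_cst// mul0r oppr0.
have h2 : {ae mu, forall x, M < `|x| -> (h x).2 = 0}.
  apply: (@ae_zero_outside M (snd \o h)) => // psi psi1 psi2 Cpsi [N psiN] psi0.
  have := w2 _ _ _ _ Cpsi psiN => /esym/eqP; rewrite eqr_oppLR => /eqP ->.
  under eq_Rintegral => x _ do rewrite (near0 _ _ _ Cpsi psi0 x).2.
  by rewrite Rintegral_cst// mul0r oppr0.
have phiM : vanishes_outside M phi.
  by move=> x xM; apply: phi0; apply: lt_trans xM; rewrite /M ltrDl.
have mh1 : measurable_fun setT (fst \o h) by case: L1.
have mh2 : measurable_fun setT (snd \o h) by case: L2.
have mI : measurable_fun setT (\1_(cbox M) : R * R -> R).
  by apply: measurable_indic; exact: measurable_cbox.
pose k x := (\1_(cbox M) x * (h x).1, \1_(cbox M) x * (h x).2).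
have mk1 : measurable_fun setT (fst \o k) by exact: measurable_funM.
have mk2 : measurable_fun setT (snd \o k) by exact: measurable_funM.
have I1 x : `|x| <= M -> \1_(cbox M) x = 1 :> R.
  by move=> xM; rewrite indicE mem_set//; apply/cboxE.
have I0 x : M < `|x| -> \1_(cbox M) x = 0 :> R.
  by move=> xM; rewrite indicE memNset// => /cboxE; rewrite leNgt xM.
exists M, k; split.
- split=> //.
  + exact: locbounded_cont.
  + split; [| |exact: L2loc_cbox L1|exact: L2loc_cbox L2].
      by move=> x /I0; rewrite /k/= => ->; rewrite mul0r.
    by move=> x /I0; rewrite /k/= => ->; rewrite mul0r.
  (* [f] has no compact support, so the weak derivative is tested with [c * f], where the cutoff [c]
     is 1 with zero partials on the box that carries [phi] and [k]. *)
  + move=> f f1 f2 Cf; have [c [c1 [c2 [Cc cM c_1 c_0]]]] := cutoff_exists M.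
    have Cp := C1dM Cc Cf.
    have pM : vanishes_outside (M + 1) (fun x => c x * f x).
      by move=> x /cM ->; rewrite mul0r.
    have [cf _ _ _ _] := Cf; have mf := continuous_measurable_plane cf.
    have [cc _ _ _ _] := Cc; have mc := continuous_measurable_plane cc.
    have {}w1 := w1 _ _ _ _ Cp pM; have {}w2 := w2 _ _ _ _ Cp pM.
    split.
    * transitivity (\int[mu]_x (phi x * (c1 x * f x + c x * f1 x))).
        apply: eq_Rintegral => x _; have [xM|Mx] := leP `|x| M; last by rewrite phiM// !mul0r.
        by rewrite c_1// (c_0 x xM).1 mul0r mul1r add0r.
      rewrite w1; congr (- _); apply: Rintegral_ae.
      - by apply: measurable_funM => //; exact: measurable_funM.
      - exact: measurable_funM.
      - apply: ae_imply h1 => x hx /=; have [xM|Mx] := leP `|x| M.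
          by rewrite c_1// I1// !mul1r.
        by rewrite hx// !mulr0 !mul0r.
    * transitivity (\int[mu]_x (phi x * (c2 x * f x + c x * f2 x))).
        apply: eq_Rintegral => x _; have [xM|Mx] := leP `|x| M; last by rewrite phiM// !mul0r.
        by rewrite c_1// (c_0 x xM).2 mul0r mul1r add0r.
      rewrite w2; congr (- _); apply: Rintegral_ae.
      - by apply: measurable_funM => //; exact: measurable_funM.
      - exact: measurable_funM.
      - apply: ae_imply h2 => x hx /=; have [xM|Mx] := leP `|x| M.
          by rewrite c_1// I1// !mul1r.
        by rewrite hx// !mulr0 !mul0r.
- move=> om g lg1 lg2; have [[mg1 _] [mg2 _]] := (lg1, lg2).
  have mphi := continuous_measurable_plane cphi.
  have mperp : measurable_fun setT (fun x : R * R => om * dot2 (perp x) (g x) * phi x).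
    apply: measurable_funM => //; apply: measurable_funM => //.
    by have [] := locbounded_perp lg1 lg2.
  apply: Rintegral_ae.
  + by apply: measurable_funD => //; apply: measurable_funD; exact: measurable_funM.
  + by apply: measurable_funD => //; apply: measurable_funD; exact: measurable_funM.
  + apply: ae_imply (ae_conj h1 h2) => x [hx1 hx2] /=; congr (_ + _); rewrite /dot2 /k/=.
    have [xM|Mx] := leP `|x| M; first by rewrite I1// !mul1r.
    by rewrite hx1// hx2// !mulr0.
Unshelve. all: by end_near. Qed.

End test_functions.

(** * Weak inequalities as signs of a residual, and their linear combinations *)

Section weak_inequalities.
Context {R : realType}.
Variables (m om : R).
Implicit Types (f phi : R * R -> R) (g k : R * R -> R * R) (M : R).
Local Notation mu := (plane_measure R).

Lemma integrable_add f1 f2 : mu.-integrable setT (EFin \o f1) ->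
  mu.-integrable setT (EFin \o f2) -> mu.-integrable setT (EFin \o (fun x => f1 x + f2 x)).
Proof. exact: (integrableD measurableT). Qed.

(** Right-hand side minus left-hand side of the weak equation as one integrand: an integral [>= 0]
    means subsolution, [<= 0] supersolution. It is linear in the pair (f, g), so combining
    inequalities is mere addition. *)
Definition residual f g phi k : R * R -> R := fun x =>
  m * f x * phi x - (dot2 (g x) (k x) + om * dot2 (perp x) (g x) * phi x).

Definition bounded_gradient f g := [/\ locbounded f, locbounded (fst \o g),
  locbounded (snd \o g) & weak_gradient f g].

Definition residual_le0 f g := bounded_gradient f g /\
  forall M phi k, test_pair M phi k -> \int[mu]_x residual f g phi k x <= 0.

Definition residual_ge0 f g := bounded_gradient f g /\
  forall M phi k, test_pair M phi k -> 0 <= \int[mu]_x residual f g phi k x.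

Lemma integrable_dot2 M phi k g : test_pair M phi k ->
  locbounded (fst \o g) -> locbounded (snd \o g) ->
  mu.-integrable setT (EFin \o (fun x => dot2 (g x) (k x))).
Proof.
move=> [_ _ _ [k1 k2 i1 i2] _] g1 g2.
have j1 := integrableM_locbounded i1 k1 g1; have j2 := integrableM_locbounded i2 k2 g2.
have := integrableD measurableT j1 j2; congr (_.-integrable _ _).
by apply/funext => x; rewrite /dot2 /= EFinD; congr (_ + _)%E; rewrite mulrC.
Qed.

Lemma integrable_phi M phi k f : test_pair M phi k -> locbounded f ->
  mu.-integrable setT (EFin \o (fun x => f x * phi x)).
Proof.
move=> [lphi phiM _ _ _] lf; apply: (@integrable_locbounded _ M); first exact: locboundedM.
by move=> x /phiM ->; rewrite mulr0.
Qed.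

Lemma residual_integral M phi k f g : test_pair M phi k -> bounded_gradient f g ->
  mu.-integrable setT (EFin \o residual f g phi k) /\
  \int[mu]_x residual f g phi k x =
    \int[mu]_x (m * f x * phi x) - rotating_form om g phi k.
Proof.
move=> tp [lf g1 g2 _].
have i1 : mu.-integrable setT (EFin \o (fun x => m * f x * phi x)).
  by apply: (integrable_phi tp); apply: locboundedM => //; exact: locbounded_cst.
have i2 : mu.-integrable setT (EFin \o (fun x => om * dot2 (perp x) (g x) * phi x)).
  apply: (integrable_phi tp); apply: locboundedM; first exact: locbounded_cst.
  exact: locbounded_perp.
have i3 : mu.-integrable setT
    (EFin \o (fun x => dot2 (g x) (k x) + om * dot2 (perp x) (g x) * phi x)).
  exact: (integrableD measurableT (integrable_dot2 tp g1 g2) i2).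
split; first exact: (integrableB measurableT i1 i3).
exact: RintegralB.
Qed.

Lemma residual_ge0_subsolution f g : residual_ge0 f g -> weak_subsolution m om f.
Proof.
move=> [bg E0]; have [_ g1 g2 wg] := bg; exists g => // phi h aphi wh.
have [M [k [tp /(_ om g g1 g2) ->]]] := test_pair_exists aphi wh.
by rewrite -subr_ge0 -(residual_integral tp bg).2; exact: E0 tp.
Qed.

Lemma residual_le0_supersolution f g : residual_le0 f g -> weak_supersolution m om f.
Proof.
move=> [bg E0]; have [_ g1 g2 wg] := bg; exists g => // phi h aphi wh.
have [M [k [tp /(_ om g g1 g2) ->]]] := test_pair_exists aphi wh.
by rewrite -subr_le0 -(residual_integral tp bg).2; exact: E0 tp.
Qed.

Lemma bounded_gradient_lin (c : R) f g f' g' : bounded_gradient f g -> bounded_gradient f' g' ->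
  bounded_gradient (fun x => f x + c * f' x)
    (fun x => ((g x).1 + c * (g' x).1, (g x).2 + c * (g' x).2)).
Proof.
move=> [lf l1 l2 [_ _ /weak_derivative1P w1 /weak_derivative2P w2]].
move=> [lf' l1' l2' [_ _ /weak_derivative1P w1' /weak_derivative2P w2']].
have lb f1 f2 : locbounded f1 -> locbounded f2 -> locbounded (fun x => f1 x + c * f2 x).
  by move=> ? ?; apply: locboundedD => //; apply: locboundedM => //; exact: locbounded_cst.
have lin f1 f2 psi N : locbounded f1 -> locbounded f2 -> continuous psi ->
    vanishes_outside N psi ->
    \int[mu]_x ((f1 x + c * f2 x) * psi x) =
    \int[mu]_x (f1 x * psi x) + c * \int[mu]_x (f2 x * psi x).
  move=> lf1 lf2 /locbounded_cont lpsi psiN.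
  have i1 : mu.-integrable setT (EFin \o (fun x => f1 x * psi x)).
    by apply: (@integrable_locbounded _ N); [exact: locboundedM|move=> x /psiN ->; rewrite mulr0].
  have i2 : mu.-integrable setT (EFin \o (fun x => f2 x * psi x)).
    by apply: (@integrable_locbounded _ N); [exact: locboundedM|move=> x /psiN ->; rewrite mulr0].
  rewrite -RintegralZl// -RintegralD//; last exact: (integrableZl measurableT c i2).
  by apply: eq_Rintegral => x _; ring.
split; [exact: lb|exact: lb|exact: lb|split].
- by apply: locbounded_L2loc; exact: lb.
- by apply: locbounded_L2loc; exact: lb.
- apply/weak_derivative1P => psi psi1 psi2 N Cpsi psiN.
  have [cp cp1 _ _ _] := Cpsi; have [psi1N _] := C1d_vanishes Cpsi psiN.
  rewrite (lin _ _ _ _ lf lf' cp1 psi1N) (lin _ _ _ _ l1 l1' cp psiN).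
  by rewrite (w1 _ _ _ _ Cpsi psiN) (w1' _ _ _ _ Cpsi psiN) mulrN opprD.
- apply/weak_derivative2P => psi psi1 psi2 N Cpsi psiN.
  have [cp _ cp2 _ _] := Cpsi; have [_ psi2N] := C1d_vanishes Cpsi psiN.
  rewrite (lin _ _ _ _ lf lf' cp2 psi2N) (lin _ _ _ _ l2 l2' cp psiN).
  by rewrite (w2 _ _ _ _ Cpsi psiN) (w2' _ _ _ _ Cpsi psiN) mulrN opprD.
Qed.

Lemma residual_lin (c : R) f g f' g' M phi k : test_pair M phi k ->
  bounded_gradient f g -> bounded_gradient f' g' ->
  \int[mu]_x residual (fun x => f x + c * f' x)
    (fun x => ((g x).1 + c * (g' x).1, (g x).2 + c * (g' x).2)) phi k x =
  \int[mu]_x residual f g phi k x + c * \int[mu]_x residual f' g' phi k x.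
Proof.
move=> tp bg bg'; have [i1 _] := residual_integral tp bg; have [i2 _] := residual_integral tp bg'.
rewrite -RintegralZl// -RintegralD//; last exact: (integrableZl measurableT c i2).
by apply: eq_Rintegral => x _; rewrite /residual /dot2 /=; ring.
Qed.

Lemma residual_le0B (c : R) f g f' g' : 0 <= c -> residual_le0 f g -> residual_ge0 f' g' ->
  residual_le0 (fun x => f x + - c * f' x)
    (fun x => ((g x).1 + - c * (g' x).1, (g x).2 + - c * (g' x).2)).
Proof.
move=> c0 [bg E] [bg' E']; split; first exact: bounded_gradient_lin.
move=> M phi k tp; rewrite (residual_lin _ tp bg bg').
by rewrite -[leRHS]addr0 lerD ?(E _ _ _ tp)// mulNr oppr_le0 mulr_ge0// (E' _ _ _ tp).
Qed.

Lemma bounded_gradient0 : bounded_gradient (fun=> 0) (fun=> (0, 0)).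
Proof.
have l0 := @locbounded_cst R 0.
split; [exact: l0|exact: l0|exact: l0|split].
- exact: (locbounded_L2loc l0).
- exact: (locbounded_L2loc l0).
- apply/weak_derivative1P => psi psi1 psi2 N _ _.
  under eq_Rintegral do rewrite mul0r; under [in RHS]eq_Rintegral do rewrite mul0r.
  by rewrite Rintegral_cst// mul0r oppr0.
- apply/weak_derivative2P => psi psi1 psi2 N _ _.
  under eq_Rintegral do rewrite mul0r; under [in RHS]eq_Rintegral do rewrite mul0r.
  by rewrite Rintegral_cst// mul0r oppr0.
Qed.

Lemma residual0 phi k : \int[mu]_x residual (fun=> 0) (fun=> (0, 0)) phi k x = 0.
Proof.
under eq_Rintegral => x _ do rewrite /residual /dot2 /= !(mulr0, mul0r, addr0, subr0).
by rewrite Rintegral_cst// mul0r.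
Qed.

Lemma residual_ge0Z (c : R) f g : 0 <= c -> residual_ge0 f g ->
  residual_ge0 (fun x => c * f x) (fun x => (c * (g x).1, c * (g x).2)).
Proof.
move=> c0 [bg E].
have -> : (fun x => c * f x) = (fun x => 0 + c * f x) by apply/funext => x; rewrite add0r.
have -> : (fun x => (c * (g x).1, c * (g x).2)) =
    (fun x => (((fun=> (0 : R, 0 : R)) x).1 + c * (g x).1,
      ((fun=> (0 : R, 0 : R)) x).2 + c * (g x).2)).
  by apply/funext => x; rewrite !add0r.
split; first exact: (bounded_gradient_lin c bounded_gradient0 bg).
move=> M phi k tp; rewrite (residual_lin c tp bounded_gradient0 bg) residual0 add0r.
by rewrite mulr_ge0// (E _ _ _ tp).
Qed.

End weak_inequalities.

(** * Nodal pieces of a solution *)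

Section nodal_pieces.
Context {R : realType}.
Variables (m om : R) (W W1 W2 W11 W12 W21 W22 : R * R -> R).
Local Notation mu := (plane_measure R).
Hypothesis CW : C1d W W1 W2.
Hypothesis CW1 : C1d W1 W11 W12.
Hypothesis CW2 : C1d W2 W21 W22.
Hypothesis eqW : forall x, W11 x + W22 x = om * dot2 (perp x) (W1 x, W2 x) - m * W x.

Let lW : locbounded W. Proof. by case: CW => cW _ _ _ _; exact: locbounded_cont. Qed.
Let lW1 : locbounded W1. Proof. by case: CW => _ cW _ _ _; exact: locbounded_cont. Qed.
Let lW2 : locbounded W2. Proof. by case: CW => _ _ cW _ _; exact: locbounded_cont. Qed.
Let lW11 : locbounded W11. Proof. by case: CW1 => _ cW _ _ _; exact: locbounded_cont. Qed.
Let lW22 : locbounded W22. Proof. by case: CW2 => _ _ cW _ _; exact: locbounded_cont. Qed.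

Lemma smooth_bounded_gradient : bounded_gradient W (fun x => (W1 x, W2 x)).
Proof.
split=> //; split; [exact: locbounded_L2loc|exact: locbounded_L2loc| |].
- apply/weak_derivative1P => psi psi1 psi2 N Cpsi psiN.
  have pN : vanishes_outside N (fun x => W x * psi x) by move=> x /psiN ->; rewrite mulr0.
  have [+ _] := integral_partial (C1dM CW Cpsi) pN.
  have [cp cp1 _ _ _] := Cpsi; have [psi1N _] := C1d_vanishes Cpsi psiN.
  rewrite RintegralD//.
  + by move=> /eqP; rewrite addrC addr_eq0 => /eqP ->.
  + apply: (@integrable_locbounded _ N); first by apply: locboundedM => //; exact: locbounded_cont.
    by move=> x /psiN ->; rewrite mulr0.
  + apply: (@integrable_locbounded _ N); first by apply: locboundedM => //; exact: locbounded_cont.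
    by move=> x /psi1N ->; rewrite mulr0.
- apply/weak_derivative2P => psi psi1 psi2 N Cpsi psiN.
  have pN : vanishes_outside N (fun x => W x * psi x) by move=> x /psiN ->; rewrite mulr0.
  have [_ +] := integral_partial (C1dM CW Cpsi) pN.
  have [cp _ cp2 _ _] := Cpsi; have [_ psi2N] := C1d_vanishes Cpsi psiN.
  rewrite RintegralD//.
  + by move=> /eqP; rewrite addrC addr_eq0 => /eqP ->.
  + apply: (@integrable_locbounded _ N); first by apply: locboundedM => //; exact: locbounded_cont.
    by move=> x /psiN ->; rewrite mulr0.
  + apply: (@integrable_locbounded _ N); first by apply: locboundedM => //; exact: locbounded_cont.
    by move=> x /psi2N ->; rewrite mulr0.
Qed.

Lemma smooth_residual M phi k : test_pair M phi k ->
  \int[mu]_x residual m om W (fun x => (W1 x, W2 x)) phi k x = 0.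
Proof.
move=> tp; have [lphi phiM _ [k1 k2 i1 i2] parts] := tp.
have [p1 _] := parts _ _ _ CW1; have [_ p2] := parts _ _ _ CW2.
have iphi f : locbounded f -> mu.-integrable setT (EFin \o (fun x => phi x * f x)).
  by move=> lf; apply: (@integrable_locbounded _ M); [exact: locboundedM|move=> x /phiM ->; rewrite mul0r].
have j1 := integrableM_locbounded i1 k1 lW1; have j2 := integrableM_locbounded i2 k2 lW2.
(* By [eqW] the zero-order and rotation terms add up to minus [phi] times the Laplacian of [W]; what
   remains is cancelled by integrating by parts with [W1] and [W2], which are themselves C^1. *)
have -> : \int[mu]_x residual m om W (fun x => (W1 x, W2 x)) phi k x =
    \int[mu]_x ((- 1) * (phi x * W11 x + phi x * W22 x + ((k x).1 * W1 x + (k x).2 * W2 x))).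
  by apply: eq_Rintegral => x _; have := eqW x; rewrite /residual /dot2 /= => e; nra.
have i3 := integrable_add (iphi _ lW11) (iphi _ lW22).
have i4 := integrable_add j1 j2.
rewrite RintegralZl//; last exact: (integrable_add i3 i4).
rewrite RintegralD//.
rewrite !RintegralD//; try exact: iphi; rewrite p1 p2.
by rewrite addrACA !addNr addr0 mulr0.
Qed.

Variable A : set (R * R).
Hypothesis AW : forall x, A x -> W x < 0.
Hypothesis oA : open A.
Hypothesis oB : open [set x | W x < 0 /\ ~ A x].

Let mA : measurable A. Proof. exact: open_measurable_plane. Qed.
Let lA : locbounded \1_A. Proof. exact: locbounded_indic. Qed.

Definition piece x := \1_A x * - W x.
Definition dpiece x := (\1_A x * - W1 x, \1_A x * - W2 x).
(** A C^1 substitute for [\1_A], supported where [- W] is at least 1/n; [deta n] times [- W1] and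
    [- W2] are its partials. *)
Let eta n x := \1_A x * stepn n (- W x).
Let deta n x := \1_A x * dstepn n (- W x).

(** Near a point with [W >= 0] the step is identically 0. Near a point with [W < 0] the indicator of
    [A] is constant, because [A] and its complement in {W < 0} are both open. No third case exists,
    so the shape of the nodal set never enters. *)
Lemma piece_cutoff_C1d n : C1d (eta n) (fun x => deta n x * - W1 x) (fun x => deta n x * - W2 x).
Proof.
apply: C1d_local => x; have [cW _ _ _ _] := CW.
have [Wx|Wx] := leP 0 (W x).
  exists (fun=> 0), (fun=> 0), (fun=> 0); split; first exact: C1d_cst.
  have : \forall y \near x, n%:R * - W y <= 1.
    have c : continuous (fun y => n%:R * - W y).
      by move=> y; apply: cvgM; [exact: cvg_cst|apply: cvgN; exact: cW].
    near=> y; apply: ltW; near: y.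
    apply: (cvgr_lt _ (c x)); rewrite (le_lt_trans _ ltr01)// mulr_ge0_le0//.
    by rewrite oppr_le0.
  apply: filterS => y Wy.
  by rewrite /eta /deta stepn_small// dstepn_small// !mulr0 !mul0r.
case: (pselect (A x)) => Ax.
  have C := C1d_comp (is_derive_stepn n) (@dstepn_cont R n) (C1dN CW).
  do 3 eexists; split; first exact: C.
  have : \forall y \near x, A y by exact: open_nbhs_nbhs.
  by apply: filterS => y Ay; rewrite /eta /deta indicE mem_set// !mul1r.
exists (fun=> 0), (fun=> 0), (fun=> 0); split; first exact: C1d_cst.
have : \forall y \near x, W y < 0 /\ ~ A y by exact: open_nbhs_nbhs.
by apply: filterS => y [_ Ay]; rewrite /eta /deta indicE memNset// !mul0r.
Unshelve. all: by end_near. Qed.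

Let eta_cvg x : eta n x @[n --> \oo] --> (\1_A x : R).
Proof.
rewrite /eta indicE; case: (boolP (x \in A)) => [|_] /=; last first.
  by under eq_cvg do rewrite mul0r; exact: cvg_cst.
rewrite inE => /AW Wx; under eq_cvg do rewrite mul1r.
by have := @stepn_cvg R (- W x); rewrite oppr_gt0 Wx.
Qed.

Let eta_bound n x : 0 <= eta n x <= 1.
Proof.
have /andP[s0 s1] := stepn_bounds n (- W x); rewrite /eta indicE.
by case: (_ \in _); rewrite ?mul1r ?mul0r ?s0 ?s1 ?lexx ?ler01.
Qed.

Let Wdeta_cvg x : - W x * deta n x @[n --> \oo] --> (0 : R).
Proof.
rewrite /deta; under eq_cvg do rewrite mulrCA.
have h : \1_A x * (- W x * dstepn n (- W x)) @[n --> \oo] --> (\1_A x * 0 : R).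
  by apply: cvgM; [exact: cvg_cst|exact: mul_dstepn_cvg].
by move: h; rewrite [X in _ --> X]mulr0.
Qed.

Let Wdeta_bound n x : `|- W x * deta n x| <= 12.
Proof.
rewrite /deta mulrCA indicE; case: (_ \in _); rewrite ?mul1r; first exact: mul_dstepn_bound.
by rewrite mul0r normr0.
Qed.

(** The product rule for [eta n * - W] has an extra term, the gradient of [W] times [W * deta n].
    That factor is bounded by 12 and tends to 0 at every point, so in the limit only the indicator
    times the gradient of [- W] survives. *)
Lemma piece_bounded_gradient : bounded_gradient piece dpiece.
Proof.
have lv : locbounded piece by apply: locboundedM => //; exact: locboundedN.
have l1 : locbounded (fst \o dpiece) by apply: locboundedM => //; exact: locboundedN.
have l2 : locbounded (snd \o dpiece) by apply: locboundedM => //; exact: locboundedN.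
have main N Wi psi psii : locbounded Wi -> continuous psi -> continuous psii ->
    vanishes_outside N psi -> vanishes_outside N psii ->
    (forall n, \int[mu]_x ((deta n x * - Wi x * - W x + eta n x * - Wi x) * psi x +
      eta n x * - W x * psii x) = 0) ->
    \int[mu]_x (piece x * psii x) = - \int[mu]_x (\1_A x * - Wi x * psi x).
  move=> lWi cp cpi pN piN F0.
  have lp := locbounded_cont cp; have lpi := locbounded_cont cpi.
  have [mW _] := lW; have [mWi bWi] := lWi; have [mp _] := lp; have [mpi _] := lpi.
  have iabs f : locbounded f -> vanishes_outside N f -> mu.-integrable setT (EFin \o (fun x => `|f x|)).
    by move=> lf fN; exact: (integrable_abse (integrable_locbounded lf fN)).
  (* 13 = 12 + 1: the bound on [- W x * deta n x] plus the bound on [eta n x]. *)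
  have i1 : mu.-integrable setT (EFin \o (fun x => `|13 * (Wi x * psi x)|)).
    apply: iabs; first by apply: locboundedM; [exact: locbounded_cst|exact: locboundedM].
    by move=> x /pN ->; rewrite !mulr0.
  have i2 : mu.-integrable setT (EFin \o (fun x => `|W x * psii x|)).
    by apply: iabs; [exact: locboundedM|move=> x /piN ->; rewrite mulr0].
  have j1 : mu.-integrable setT (EFin \o (fun x => \1_A x * - Wi x * psi x)).
    apply: (@integrable_locbounded _ N); last by move=> x /pN ->; rewrite mulr0.
    by apply: locboundedM => //; apply: locboundedM => //; exact: locboundedN.
  have j2 : mu.-integrable setT (EFin \o (fun x => piece x * psii x)).
    by apply: (@integrable_locbounded _ N); [exact: locboundedM|move=> x /piN ->; rewrite mulr0].
  have [_ cF] : mu.-integrable setT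
      (EFin \o (fun x => (0 * - Wi x + \1_A x * - Wi x) * psi x + \1_A x * - W x * psii x)) /\
    (\int[mu]_x ((deta n x * - Wi x * - W x + eta n x * - Wi x) * psi x +
      eta n x * - W x * psii x)) @[n --> \oo] -->
    \int[mu]_x ((0 * - Wi x + \1_A x * - Wi x) * psi x + \1_A x * - W x * psii x).
    apply: Rintegral_dominated (integrable_add i1 i2) _ _.
    - move=> n.
      have me : measurable_fun setT (eta n).
        by apply: continuous_measurable_plane; case: (piece_cutoff_C1d n).
      have md : measurable_fun setT (deta n).
        apply: measurable_funM; first by case: lA.
        apply: continuous_measurable_plane => x.
        apply: (@continuous_comp _ _ _ (fun x => - W x) (dstepn n)); last exact: dstepn_cont.
        by apply: cvgN; case: CW => + _ _ _ _; apply.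
      have mNWi : measurable_fun setT (fun x => - Wi x) by exact: measurableT_comp.
      have mNW : measurable_fun setT (fun x => - W x) by exact: measurableT_comp.
      by apply: measurable_funD; apply: measurable_funM => //; [apply: measurable_funD|];
        apply: measurable_funM => //; exact: measurable_funM.
    - move=> n x; have /andP[e0 e1] := eta_bound n x; have d12 := Wdeta_bound n x.
      rewrite (le_trans (ler_normD _ _))// lerD//.
        rewrite !normrM mulrA ler_wpM2r// [`|13|]ger0_norm//.
        rewrite (_ : _ + _ = (- W x * deta n x + eta n x) * - Wi x); last by ring.
        rewrite normrM normrN ler_wpM2r// (le_trans (ler_normD _ _))//.
        by rewrite [`|eta n x|]ger0_norm//; lra.
      by move: (eta n x) e0 e1 => e e0 e1; rewrite !normrM normrN ler_wpM2r// (ger0_norm e0) ler_piMl.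
    - move=> x; apply: cvgD; last first.
        by apply: cvgM; [apply: cvgM; [exact: eta_cvg|exact: cvg_cst]|exact: cvg_cst].
      apply: cvgM; last exact: cvg_cst.
      rewrite (_ : (fun n => _) = (fun n => - W x * deta n x * - Wi x + eta n x * - Wi x)).
        by apply: cvgD; apply: cvgM; [exact: Wdeta_cvg|exact: cvg_cst|exact: eta_cvg|exact: cvg_cst].
      by apply/funext => n; ring.
  have := cvg_unique (@norm_hausdorff _ _) cF; rewrite (_ : (fun n => _) = fun=> 0); last first.
    by apply/funext => n; exact: F0.
  move=> /(_ _ 0 (cvg_cst _)); under eq_Rintegral do rewrite mul0r add0r.
  by rewrite RintegralD// => /eqP; rewrite addrC addr_eq0 => /eqP ->.
split=> //; split; [exact: locbounded_L2loc|exact: locbounded_L2loc| |].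
- apply/weak_derivative1P => psi psi1 psi2 N Cpsi psiN.
  have [cp cp1 _ _ _] := Cpsi; have [psi1N _] := C1d_vanishes Cpsi psiN.
  apply: (main N W1 psi psi1) => // n.
  have [<- _] := integral_partial (C1dM (C1dM (piece_cutoff_C1d n) (C1dN CW)) Cpsi)
    (fun x xN => eq_trans (congr1 (fun t => eta n x * - W x * t) (psiN x xN)) (mulr0 _)).
  by [].
- apply/weak_derivative2P => psi psi1 psi2 N Cpsi psiN.
  have [cp _ cp2 _ _] := Cpsi; have [_ psi2N] := C1d_vanishes Cpsi psiN.
  apply: (main N W2 psi psi2) => // n.
  have [_ <-] := integral_partial (C1dM (C1dM (piece_cutoff_C1d n) (C1dN CW)) Cpsi)
    (fun x xN => eq_trans (congr1 (fun t => eta n x * - W x * t) (psiN x xN)) (mulr0 _)).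
  by [].
Qed.

(* Testing the equation of [W] with [eta n * phi] leaves the extra term
   [phi * deta n * |grad W|^2], which has a sign. *)
Lemma piece_residual_ge0 : residual_ge0 m om piece dpiece.
Proof.
split; first exact: piece_bounded_gradient.
move=> M phi k tp; have [lphi phiM phi0 [k1 k2 i1 i2] parts] := tp.
have [mphi _] := lphi.
have lap := locboundedD lW11 lW22.
have j1 := integrableM_locbounded i1 k1 lW1; have j2 := integrableM_locbounded i2 k2 lW2.
pose G x := phi x * (W11 x + W22 x) + ((k x).1 * W1 x + (k x).2 * W2 x).
have iG : mu.-integrable setT (EFin \o G).
  apply: (integrable_add _ (integrable_add j1 j2)).
  by apply: (@integrable_locbounded _ M); [exact: locboundedM|move=> x /phiM ->; rewrite mul0r].
have mG : measurable_fun setT G by apply/measurable_EFinP; exact: measurable_int iG.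
have me n : measurable_fun setT (eta n).
  by apply: continuous_measurable_plane; case: (piece_cutoff_C1d n).
have [_ cG] : mu.-integrable setT (EFin \o (fun x => \1_A x * G x)) /\
    (\int[mu]_x (eta n x * G x)) @[n --> \oo] --> \int[mu]_x (\1_A x * G x).
  apply: Rintegral_dominated (integrable_abse iG) _ _.
  - by move=> n; exact: measurable_funM.
  - move=> n x; have /andP[e0 e1] := eta_bound n x.
    by move: (eta n x) e0 e1 => e e0 e1; rewrite normrM (ger0_norm e0) ler_piMl.
  - by move=> x; apply: cvgM; [exact: eta_cvg|exact: cvg_cst].
(* The piece is [- W] on [A], so the equation turns its residual into [phi] times the Laplacian plus
   [k] dotted with the gradient of [W], restricted to [A]. *)
have -> : \int[mu]_x residual m om piece dpiece phi k x = \int[mu]_x (\1_A x * G x).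
  apply: eq_Rintegral => x _; rewrite /residual /piece /dpiece /G /dot2 /=.
  by rewrite eqW /dot2 /=; ring.
rewrite -(cvg_lim _ cG)//; apply: limr_ge; first by apply/cvg_ex; eexists; exact: cG.
apply: nearW => n.
have [p1 _] := parts _ _ _ (C1dM (piece_cutoff_C1d n) CW1).
have [_ p2] := parts _ _ _ (C1dM (piece_cutoff_C1d n) CW2).
have le : locbounded (eta n) by apply: locbounded_cont; case: (piece_cutoff_C1d n).
have q1 := integrableM_locbounded i1 k1 (locboundedM le lW1).
have q2 := integrableM_locbounded i2 k2 (locboundedM le lW2).
have [_ le1 le2 _ _] := piece_cutoff_C1d n.
have iphi f : locbounded f -> mu.-integrable setT (EFin \o (fun x => phi x * f x)).
  by move=> lf; apply: (@integrable_locbounded _ M); [exact: locboundedM|move=> x /phiM ->; rewrite mul0r].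
pose T x := phi x * (deta n x * - W1 x * - W1 x + deta n x * - W2 x * - W2 x).
have iT : mu.-integrable setT (EFin \o T).
  apply: iphi; apply: locboundedD; apply: locboundedM; [|exact: locboundedN| |exact: locboundedN];
    exact: locbounded_cont.
have r1 : mu.-integrable setT (EFin \o (fun x => phi x * (deta n x * - W1 x * W1 x + eta n x * W11 x))).
  apply: iphi; apply: locboundedD; apply: locboundedM => //; exact: locbounded_cont.
have r2 : mu.-integrable setT (EFin \o (fun x => phi x * (deta n x * - W2 x * W2 x + eta n x * W22 x))).
  apply: iphi; apply: locboundedD; apply: locboundedM => //; exact: locbounded_cont.
(* The terms other than [T] are exactly those of the integration by parts of [phi] against the
   divergence of the field [eta n] times grad [W], and cancel; [T] compensates the derivative of the
   cutoff. *)
have -> : \int[mu]_x (eta n x * G x) = \int[mu]_x (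
    phi x * (deta n x * - W1 x * W1 x + eta n x * W11 x) +
    phi x * (deta n x * - W2 x * W2 x + eta n x * W22 x) +
    ((k x).1 * (eta n x * W1 x) + (k x).2 * (eta n x * W2 x)) + T x).
  by apply: eq_Rintegral => x _; rewrite /T /G; ring.
have r12 := integrable_add r1 r2; have q12 := integrable_add q1 q2.
rewrite RintegralD//; last exact: (integrable_add r12 q12).
rewrite (RintegralD _ r12 q12)// (RintegralD _ r1 r2)// (RintegralD _ q1 q2)// p1 p2.
rewrite addrACA !addNr addr0 add0r; apply: Rintegral_ge0 => x _.
have d0 : 0 <= deta n x by apply: mulr_ge0; [rewrite indicE|exact: dstepn_ge0].
rewrite (_ : T x = phi x * (deta n x * (W1 x ^+ 2 + W2 x ^+ 2))); last by rewrite /T; ring.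
apply: mulr_ge0; first exact: phi0.
by apply: mulr_ge0 => //; apply: addr_ge0; exact: sqr_ge0.
Qed.

End nodal_pieces.

(** * The star configuration *)

Section star_configuration.
Context {R : realType}.
Local Notation mu := (plane_measure R).

Lemma open_not_null (U : set (R * R)) (P : R * R -> Prop) x : open U -> U x ->
  (forall y, U y -> ~ P y) -> ~ {ae mu, forall y, P y}.
Proof.
move=> oU Ux UP [N [mN N0 HN]].
have /nbhs_ballP[e /= e0 eU] : nbhs x U by exact: open_nbhs_nbhs.
have BN : ball x.1 e `*` ball x.2 e `<=` N.
  by move=> y yB; apply: HN => /= /(UP y); apply; exact: eU.
have : (mu (ball x.1 e `*` ball x.2 e) <= mu N)%E.
  apply: le_measure => //; rewrite inE //.
  by apply: measurableX; exact: measurable_ball.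
have E t : @lebesgue_measure R (ball t e) = (e *+ 2)%:E.
  by rewrite lebesgue_measure_ball// ltW.
have -> : mu (ball x.1 e `*` ball x.2 e) = ((e *+ 2) * (e *+ 2))%:E.
  transitivity (@lebesgue_measure R (ball x.1 e) * @lebesgue_measure R (ball x.2 e))%E.
    by apply: product_measure1E; exact: measurable_ball.
  by rewrite !E EFinM.
by rewrite N0 lee_fin leNgt mulr_gt0// mulrn_wgt0.
Qed.

Lemma residual_le0_sum (m om : R) (I : Type) (s : seq I) (c : I -> R)
    (v : I -> R * R -> R) (f : R * R -> R) (g : R * R -> R * R) :
  (forall j, 0 <= c j) -> (forall j, exists dv, residual_ge0 m om (v j) dv) ->
  residual_le0 m om f g ->
  exists g', residual_le0 m om (fun x => f x - \sum_(j <- s) c j * v j x) g'.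
Proof.
move=> c0 hv hf; elim: s => [|j s [g' IH]].
  by exists g; under eq_fun do rewrite big_nil subr0.
have [dv hj] := hv j; eexists.
have -> : (fun x => f x - \sum_(i <- j :: s) c i * v i x) =
    (fun x => (f x - \sum_(i <- s) c i * v i x) + - c j * v j x).
  by apply/funext => x; rewrite big_cons; ring.
exact: (residual_le0B (c0 j) IH hj).
Qed.

Variables (m om : R) (W W1 W2 W11 W12 W21 W22 : R * R -> R).
Hypothesis CW : C1d W W1 W2.
Hypothesis CW1 : C1d W1 W11 W12.
Hypothesis CW2 : C1d W2 W21 W22.
Hypothesis eqW : forall x, W11 x + W22 x = om * dot2 (perp x) (W1 x, W2 x) - m * W x.

Lemma residual_le0_smooth (c : R) :
  exists g, residual_le0 m om (fun x => c * W x) g.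
Proof.
have bW := smooth_bounded_gradient CW; eexists.
have -> : (fun x => c * W x) = (fun x => 0 + c * W x) by apply/funext => x; rewrite add0r.
split; first exact: (bounded_gradient_lin c bounded_gradient0 bW).
move=> M phi k tp; rewrite (residual_lin m om c tp bounded_gradient0 bW).
by rewrite residual0 (smooth_residual CW CW1 CW2 eqW tp) mulr0 addr0.
Qed.

Variables (K : nat) (a : 'I_K -> 'I_K -> R) (i0 : 'I_K) (col : R * R -> 'I_K).
Hypothesis a_gt0 : forall i j, i != j -> 0 < a i j.
Hypothesis col_neq : forall x, W x < 0 -> col x != i0.
Hypothesis col_loc : forall x, W x < 0 -> \forall y \near x, col y = col x.
Hypothesis col_onto : forall j, j != i0 -> exists x, W x < 0 /\ col x = j.
Hypothesis W_pos : exists x, 0 < W x.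

Let cW : continuous W. Proof. by case: CW. Qed.

Let region j : set (R * R) :=
  if j == i0 then [set x | 0 < W x] else [set x | W x < 0 /\ col x = j].

(** The positive part of [W] is encoded as the piece of [- W] on {W > 0}. As [- W] solves the same
    linear equation, one lemma makes the centre and all leaves subsolutions. *)
Let v j : R * R -> R :=
  if j == i0 then piece (fun x => - W x) (region i0) else piece W (region j).

Let Wneg_open : open [set x | W x < 0].
Proof. by have /continuousP c := cW; exact: (c [set t : R | t < 0] (@open_lt R 0)). Qed.

Let Wpos_open : open [set x | 0 < W x].
Proof. by have /continuousP c := cW; exact: (c [set t : R | 0 < t] (@open_gt R 0)). Qed.

Let region_open j : open (region j).
Proof.
rewrite /region; case: eqP => // _; rewrite openE => x [Wx cx].
have h1 : \forall y \near x, W y < 0 by apply: open_nbhs_nbhs; split.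
have h2 := col_loc Wx; near=> y; split; first by near: y.
by rewrite -cx; near: y.
Unshelve. all: by end_near. Qed.

Let v_residual j : exists dv, residual_ge0 m om (v j) dv.
Proof.
rewrite /v; case: eqP => [_|/eqP ji].
  eexists; apply: (piece_residual_ge0 (C1dN CW) (C1dN CW1) (C1dN CW2)) => //.
  - by move=> x; have := eqW x; rewrite /dot2 /= => e; nra.
  - by move=> x; rewrite /region eqxx/= oppr_lt0.
  - rewrite (_ : [set _ | _] = set0); first exact: open0.
    by apply/seteqP; split=> // x [/=]; rewrite /region eqxx/= oppr_lt0.
eexists; apply: (piece_residual_ge0 CW CW1 CW2) => //.
- by move=> x; rewrite /region (negbTE ji) => -[].
- rewrite openE => x [Wx cx].
  have h1 : \forall y \near x, W y < 0 by apply: open_nbhs_nbhs; split.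
  have h2 := col_loc Wx; near=> y; split; first by near: y.
  rewrite /region (negbTE ji) => -[_ cy]; apply: cx; rewrite /region (negbTE ji); split=> //.
  by rewrite -cy; apply/esym; near: y.
Unshelve. all: by end_near. Qed.

Let vE j x : v j x = if j == i0 then Num.max (W x) 0 else
  if (W x < 0) && (col x == j) then - W x else 0.
Proof.
rewrite /v /piece; case: eqP => [_|/eqP ji]; rewrite indicE.
  rewrite opprK /region eqxx; case: (ltP 0 (W x)) => Wx.
    by rewrite mem_set// mul1r.
  by rewrite memNset ?mul0r//= => /(le_lt_trans Wx); rewrite ltxx.
rewrite /region (negbTE ji); case: andP => [[Wx /eqP cx]|h]; first by rewrite mem_set// mul1r.
by rewrite memNset ?mul0r// => -[Wx cx]; apply: h; rewrite Wx cx eqxx.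
Qed.

Let v_ge0 j x : 0 <= v j x.
Proof.
rewrite vE; case: ifP => _; first by rewrite le_max lexx orbT.
by case: ifP => // /andP[/ltW]; rewrite oppr_ge0.
Qed.

Let v_sum x : W x = v i0 x - \sum_(j < K | j != i0) v j x.
Proof.
have [Wx|Wx] := ltP (W x) 0.
  rewrite vE eqxx (max_idPr (ltW Wx)) (bigD1 (col x)) ?col_neq//= big1 => [|j /andP[ji jc]].
    by rewrite vE (negbTE (col_neq Wx)) Wx eqxx/=; ring.
  by rewrite vE (negbTE ji) eq_sym (negbTE jc) andbF.
rewrite vE eqxx (max_idPl Wx) big1 ?subr0// => j ji.
by rewrite vE (negbTE ji) ltNge Wx.
Qed.

(** Chosen so that [a i0 j / a j i0 * b j = 1], which gives every leaf unit weight in the hat of the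
    centre. The same ratio [a i i0 / a i0 i = b i] multiplies the centre in the hat of leaf [i], so
    both hats fit the same [W]. *)
Let b j : R := if j == i0 then 1 else a j i0 / a i0 j.

Let b_gt0 j : 0 < b j.
Proof.
rewrite /b; case: eqP => [_|/eqP ji]; first exact: ltr01.
by rewrite divr_gt0 ?a_gt0// eq_sym.
Qed.

Let u j x := b j * v j x.

Lemma hatu_center x : hatu a u i0 x = W x.
Proof.
rewrite /hatu v_sum /u /b eqxx mul1r; congr (_ - _); apply: eq_bigr => j ji.
have h1 := a_gt0 ji; have h2 : 0 < a i0 j by rewrite a_gt0// eq_sym.
rewrite (negbTE ji); field.
by rewrite !gt_eqF.
Qed.

(** Hat and [- b i * W] agree on the centre and on leaf [i]. On another leaf [j], [- b i * W] equals
    [b i * v j] while the hat is [- (a i j / a j i) * b j * v j]; the coefficient is their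
    difference, and it is nonnegative. *)
Lemma hatu_leaf i x : i != i0 -> hatu a u i x = - b i * W x -
  \sum_(j < K) (if (j == i) || (j == i0) then 0 else b i + a i j / a j i * b j) * v j x.
Proof.
move=> ii; rewrite (v_sum x) /hatu.
have -> : \sum_(j < K | j != i) a i j / a j i * u j x =
    b i * v i0 x + \sum_(j < K | (j != i) && (j != i0)) a i j / a j i * u j x.
  rewrite (bigD1 i0) 1?eq_sym//=; congr (_ + _).
  by rewrite /u /b eqxx (negbTE ii) mul1r.
have -> : \sum_(j < K | j != i0) v j x =
    v i x + \sum_(j < K | (j != i) && (j != i0)) v j x.
  by rewrite (bigD1 i)//=; congr (_ + _); apply: eq_bigl => j; rewrite andbC.
have -> : \sum_(j < K) (if (j == i) || (j == i0) then 0 else b i + a i j / a j i * b j) * v j x =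
    b i * (\sum_(j < K | (j != i) && (j != i0)) v j x) +
    \sum_(j < K | (j != i) && (j != i0)) a i j / a j i * u j x.
  rewrite mulr_sumr -big_split/= [RHS]big_mkcond/=; apply: eq_bigr => j _.
  rewrite -negb_or; case: (_ || _); rewrite /= ?mul0r// /u; ring.
by rewrite {1}/u; ring.
Qed.

Lemma star_solution : exists u, entire_segregated_solution a m om u.
Proof.
exists u; have hu j : exists du, residual_ge0 m om (u j) du.
  have [dv hv] := v_residual j; eexists.
  exact: (residual_ge0Z (ltW (b_gt0 j)) hv).
split.
- move=> i; have [du [[lu _ _ wu] _]] := hu i; split; first exact: locbounded_L2loc.
  by exists du.
- by move=> i; apply: aeW => x; rewrite mulr_ge0// ltW.
- move=> i; have [x rx] : exists x, region i x.
    rewrite /region; case: eqP => [_//|/eqP ii].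
    by have [x [? ?]] := col_onto ii; exists x.
  suff h : forall y, region i y -> u i y <> 0.
    exact: (open_not_null (P := fun y => u i y = 0) (@region_open i) rx h).
  move=> y; rewrite /region /u => ry.
  apply/eqP; rewrite mulf_neq0 ?gt_eqF// vE; move: ry; case: eqP => _.
    by move=> /= Wy; rewrite (max_idPl (ltW Wy)).
  by move=> [Wy ->]; rewrite Wy eqxx/= oppr_gt0.
- move=> i; have [du hdu] := hu i; split; first exact: residual_ge0_subsolution hdu.
  have [->|ii] := eqVneq i i0.
    have [g hg] := residual_le0_smooth 1; apply: (residual_le0_supersolution (g := g)).
    by rewrite (_ : hatu a u i0 = fun x => 1 * W x)//; apply/funext => x; rewrite mul1r hatu_center.
  have [g hg] := residual_le0_smooth (- b i).
  have [|g' hg'] := residual_le0_sum (index_enum 'I_K)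
    (c := fun j => if (j == i) || (j == i0) then 0 else b i + a i j / a j i * b j) _ v_residual hg.
    move=> j; case: ifP => // /negbT; rewrite negb_or => /andP[ji j0].
    by rewrite addr_ge0 ?mulr_ge0 ?invr_ge0// ltW// ?a_gt0// eq_sym.
  apply: (residual_le0_supersolution (g := g')).
  rewrite (_ : hatu a u i = (fun x => - b i * W x - \sum_(j < K)
    (if (j == i) || (j == i0) then 0 else b i + a i j / a j i * b j) * v j x))//.
  by apply/funext => x; exact: hatu_leaf.
- move=> i j ij; apply: aeW => x; rewrite /u !vE.
  have [ii|ii] := eqVneq i i0; have [jj|jj] := eqVneq j i0.
  + by move: ij; rewrite ii jj eqxx.
  + by case: (ltP (W x) 0) => Wx; rewrite ?mulr0 ?mul0r.
  + by case: (ltP (W x) 0) => Wx; rewrite ?mulr0 ?mul0r.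
  + case: (W x < 0) => /=; last by rewrite !mulr0.
    case: eqP => [ci|_]; last by rewrite !mulr0 mul0r.
    by rewrite ci (negbTE ij) !mulr0.
Qed.

End star_configuration.

(** * The rotating mode *)

Section power_series.
Context {R : realType}.
Implicit Types (c d : nat -> R) (x : R).

Definition psum c x : R := limn (pseries c x).

(** Domination by the coefficients of C exp(M x). Termwise differentiation only replaces C by C M,
    so all derived series converge on the whole line. *)
Definition exp_bounded c := exists C M : R, [/\ 0 <= C, 0 <= M &
  forall n, `|c n| <= C * (M ^+ n / n`!%:R)].

Lemma exp_bounded_cvg c x : exp_bounded c -> pseries c x @ \oo --> psum c x.
Proof.
move=> [C [M [C0 M0 cM]]]; apply: normed_cvg.
apply: (@series_le_cvg _ _ (C *: exp_coeff (M * `|x|))) => [n|n|n|].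
- exact: normr_ge0.
- by rewrite mulr_ge0// divr_ge0// exprn_ge0// mulr_ge0.
- rewrite /= normrM normrX (le_trans (ler_wpM2r _ (cM n)))// ?exprn_ge0//.
  have -> : (C *: exp_coeff (M * `|x|)) n = C * ((M * `|x|) ^+ n / n`!%:R) by [].
  by rewrite exprMn -mulrA [X in C * X]mulrAC.
- exact: (is_cvg_seriesZ (is_cvg_series_exp_coeff _)).
Qed.

Lemma exp_bounded_diffs c : exp_bounded c -> exp_bounded (pseries_diffs c).
Proof.
move=> [C [M [C0 M0 cM]]]; exists (C * M), M; split=> // [|n]; first exact: mulr_ge0.
rewrite /pseries_diffs normrM ger0_norm//.
rewrite (le_trans (ler_wpM2l _ (cM n.+1)))//.
rewrite factS natrM exprS invfM.
rewrite (_ : n.+1%:R * _ = (n.+1%:R / n.+1%:R) * (C * M * (M ^+ n / n`!%:R))); last by ring.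
by rewrite divff ?mul1r// pnatr_eq0.
Qed.

Lemma is_derive_psum c x : exp_bounded c ->
  is_derive x (1 : R) (psum c) (psum (pseries_diffs c) x).
Proof.
move=> bc; have bd := exp_bounded_diffs bc; have bdd := exp_bounded_diffs bd.
apply: (@pseries_snd_diffs _ c (`|x| + 1)).
- by apply/cvg_ex; eexists; exact: exp_bounded_cvg.
- by apply/cvg_ex; eexists; exact: exp_bounded_cvg.
- by apply/cvg_ex; eexists; exact: exp_bounded_cvg.
- by rewrite [ltRHS]ger0_norm ?addr_ge0// ltrDl.
Qed.

Lemma psum_lin (s t : R) c d x : exp_bounded c -> exp_bounded d ->
  pseries (fun n => s * c n + t * d n) x @ \oo --> s * psum c x + t * psum d x.
Proof.
move=> bc bd; have cc := exp_bounded_cvg (x := x) bc; have cd := exp_bounded_cvg (x := x) bd.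
rewrite (_ : pseries _ _ = fun n => s * pseries c x n + t * pseries d x n).
  by apply: cvgD; apply: cvgM => //; exact: cvg_cst.
apply/funext => n; rewrite /pseries /series /= !mulr_sumr -big_split/=.
by apply: eq_bigr => i _; ring.
Qed.

Lemma psum_diffs_mulx d x : exp_bounded d ->
  pseries (fun n => n%:R * d n) x @ \oo --> x * psum (pseries_diffs d) x.
Proof.
move=> bd; have cd := exp_bounded_cvg (x := x) (exp_bounded_diffs bd).
have h := pseries_diffs_equiv (cvgP _ cd).
rewrite (_ : pseries _ _ = fun n => x * series (fun i => i%:R * d i * x ^+ i.-1) n).
  by apply: cvgM; [exact: cvg_cst|exact: h].
apply/funext => n; rewrite /pseries /series /= mulr_sumr; apply: eq_bigr => -[|i] _ /=.
  by rewrite !mul0r mulr0.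
by rewrite exprS; ring.
Qed.

Lemma psum_at0 c : exp_bounded c -> psum c 0 = c 0.
Proof.
move=> bc; apply: (cvg_unique (@norm_hausdorff _ _) (exp_bounded_cvg (x := 0) bc)).
(* The partial sums equal [c 0] only from the first term on; the shift discards the empty sum at
   index 0. *)
rewrite /mkset -cvg_shiftS (_ : (fun n => _) = fun=> c 0); first exact: cvg_cst.
apply/funext => n; rewrite /pseries /series /= big_nat_recl//= expr0 mulr1.
by rewrite big1 ?addr0// => i _; rewrite exprS mul0r mulr0.
Qed.

Variables (N : nat) (k1 k2 : R).

(** Complex coefficients as pairs. Matching powers x^n, the terms x g'' and (N + 1) g' contribute (n
    + 1) n and (N + 1) (n + 1) times the next coefficient, in total (n + 1) (n + 1 + N). *)
Fixpoint frobenius n : R * R := if n is n'.+1 then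
  let c := frobenius n' in let d := n'.+1%:R * (n'.+1 + N)%:R in
  ((k1 * c.1 - k2 * c.2) / d, (k1 * c.2 + k2 * c.1) / d) else (1, 0).

(** The norm |Re| + |Im| is submultiplicative for complex products, and each step divides by at
    least n + 1. *)
Lemma frobenius_bound n :
  `|(frobenius n).1| + `|(frobenius n).2| <= (`|k1| + `|k2|) ^+ n / n`!%:R.
Proof.
elim: n => [|n IH]; first by rewrite /= normr1 normr0 addr0 expr0 fact0 divr1.
rewrite [frobenius _]/=; set c := frobenius n in IH *; cbv zeta.
set d : R := n.+1%:R * (n.+1 + N)%:R.
have d_ge : n.+1%:R <= d by rewrite ler_peMr// ler1n addSn.
have d0 : 0 < d by apply: lt_le_trans d_ge; rewrite ltr0n.
rewrite /= !normrM !normfV !(ger0_norm (ltW d0)) -mulrDl.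
have -> : (`|k1| + `|k2|) ^+ n.+1 / n.+1`!%:R =
    (`|k1| + `|k2|) * ((`|k1| + `|k2|) ^+ n / n`!%:R) * n.+1%:R^-1.
  by rewrite factS natrM exprS invfM; ring.
apply: ler_pM; [by rewrite addr_ge0|by rewrite invr_ge0 ltW| |by rewrite lef_pV2 ?posrE].
apply: (@le_trans _ _ ((`|k1| + `|k2|) * (`|c.1| + `|c.2|))).
  have h1 := ler_normB (k1 * c.1) (k2 * c.2); have h2 := ler_normD (k1 * c.2) (k2 * c.1).
  by rewrite !normrM in h1 h2; nra.
by rewrite ler_wpM2l// addr_ge0.
Qed.

(* Frobenius' method: [p + i q] solves [x g'' + (N + 1) g' = (k1 + i k2) g]. *)
Lemma frobenius_solution : exists p p1 p2 q q1 q2 : R -> R,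
  [/\ (forall x, is_derive x (1 : R) p (p1 x)) /\ (forall x, is_derive x (1 : R) q (q1 x)),
    (forall x, is_derive x (1 : R) p1 (p2 x)) /\ (forall x, is_derive x (1 : R) q1 (q2 x)),
    continuous p2 /\ continuous q2,
    forall x, x * p2 x + N.+1%:R * p1 x = k1 * p x - k2 * q x /\
              x * q2 x + N.+1%:R * q1 x = k1 * q x + k2 * p x & p 0 = 1 /\ q 0 = 0].
Proof.
pose a n := (frobenius n).1; pose b n := (frobenius n).2.
have K0 : 0 <= `|k1| + `|k2| by rewrite addr_ge0.
have ba : exp_bounded a.
  exists 1, (`|k1| + `|k2|); split=> // n; rewrite mul1r.
  by rewrite (le_trans _ (frobenius_bound n))// lerDl.
have bb : exp_bounded b.
  exists 1, (`|k1| + `|k2|); split=> // n; rewrite mul1r.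
  by rewrite (le_trans _ (frobenius_bound n))// lerDr.
have bda := exp_bounded_diffs ba; have bdb := exp_bounded_diffs bb.
have ode c e s t x : exp_bounded c -> exp_bounded e -> (forall n, 
    n.+1%:R * (n.+1 + N)%:R * c n.+1 = s * c n + t * e n) ->
    x * psum (pseries_diffs (pseries_diffs c)) x + N.+1%:R * psum (pseries_diffs c) x =
    s * psum c x + t * psum e x.
  move=> bc be rec; have bdc := exp_bounded_diffs bc.
  have h1 := psum_diffs_mulx (x := x) bdc; have h2 := @psum_lin s t _ _ x bc be.
  have h3 := @psum_lin N.+1%:R 0 _ _ x bdc bdc; rewrite mul0r addr0 in h3.
  apply: (cvg_unique (@norm_hausdorff _ _) (cvgD h1 h3)).
  rewrite (_ : _ + _ = pseries (fun n => s * c n + t * e n) x)//.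
  apply/funext => n; rewrite fctE /pseries /series /= -big_split/=.
  apply: eq_bigr => i _; rewrite -rec /pseries_diffs -mulrDl; congr (_ * _).
  rewrite mul0r addr0 -mulrDl -natrD addnS addSn; ring.
exists (psum a), (psum (pseries_diffs a)), (psum (pseries_diffs (pseries_diffs a))).
exists (psum b), (psum (pseries_diffs b)), (psum (pseries_diffs (pseries_diffs b))).
have rd n : (n.+1%:R * (n.+1 + N)%:R : R) != 0 by rewrite mulf_neq0// pnatr_eq0.
split.
- by split=> x; exact: is_derive_psum.
- by split=> x; exact: is_derive_psum.
- split; apply: is_derive_cont => x; apply: is_derive_psum; exact: exp_bounded_diffs.
- move=> x; split.
    rewrite (ode a b k1 (- k2))// ?mulNr// => n.
    by rewrite /a /b /= mulrC divfK// mulNr.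
  by rewrite (ode b a k1 k2)// => n; rewrite /a /b /= mulrC divfK.
- by rewrite !psum_at0.
Qed.

End power_series.

(** * Functions z^k g(|z|^2) and their Laplacian *)

Section angular_modes.
Context {R : realType}.
Implicit Types (f g : R -> R) (k : nat) (x : R * R).

(* Real and imaginary parts of [(x.1 + i x.2) ^ k]. *)
Fixpoint cpow k x : R * R := if k is k'.+1 then
  (x.1 * (cpow k' x).1 - x.2 * (cpow k' x).2, x.1 * (cpow k' x).2 + x.2 * (cpow k' x).1)
  else (1, 0).

Definition sqnorm x : R := x.1 ^+ 2 + x.2 ^+ 2.

(* Real and imaginary parts of [(x.1 + i x.2) ^ k * (f + i g) (|x| ^ 2)]. *)
Definition re_mode k f g x := (cpow k x).1 * f (sqnorm x) - (cpow k x).2 * g (sqnorm x).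
Definition im_mode k f g x := (cpow k x).1 * g (sqnorm x) + (cpow k x).2 * f (sqnorm x).

Lemma C1d_sqnorm : C1d sqnorm (fun x => 2 * x.1) (fun x => 2 * x.2).
Proof.
apply: C1d_eq (C1dD (C1dM (@C1d_fst R) (@C1d_fst R)) (C1dM (@C1d_snd R) (@C1d_snd R))) _ _ => x.
  by ring.
by ring.
Qed.

(** The first partial of z^k is k z^(k-1), the second is i times it. For k = 0 the truncated
    predecessor is harmless, being multiplied by 0. *)
Lemma C1d_cpow k :
  C1d (fun x => (cpow k x).1) (fun x => k%:R * (cpow k.-1 x).1) (fun x => - (k%:R * (cpow k.-1 x).2)) /\
  C1d (fun x => (cpow k x).2) (fun x => k%:R * (cpow k.-1 x).2) (fun x => k%:R * (cpow k.-1 x).1).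
Proof.
elim: k => [|k [IH1 IH2]].
  split; [apply: C1d_eq (C1d_cst 1) _ _|apply: C1d_eq (C1d_cst 0) _ _] => x;
    by rewrite mul0r ?oppr0.
have f1 := @C1d_fst R; have f2 := @C1d_snd R.
split.
  apply: C1d_eq (C1dD (C1dM f1 IH1) (C1dN (C1dM f2 IH2))) _ _ => x;
    case: k {IH1 IH2} => [|k] /=; rewrite -?natr1 /=; ring.
apply: C1d_eq (C1dD (C1dM f1 IH2) (C1dM f2 IH1)) _ _ => x;
    case: k {IH1 IH2} => [|k] /=; rewrite -?natr1 /=; ring.
Qed.

Lemma C1d_re_mode k f f1 g g1 : (forall t, is_derive t (1 : R) f (f1 t)) ->
  (forall t, is_derive t (1 : R) g (g1 t)) -> continuous f1 -> continuous g1 ->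
  C1d (re_mode k f g)
    (fun x => k%:R * re_mode k.-1 f g x + 2 * x.1 * re_mode k f1 g1 x)
    (fun x => - (k%:R * im_mode k.-1 f g x) + 2 * x.2 * re_mode k f1 g1 x).
Proof.
move=> df dg cf cg; have [c1 c2] := C1d_cpow k.
have Cf := C1d_comp df cf C1d_sqnorm; have Cg := C1d_comp dg cg C1d_sqnorm.
apply: C1d_eq (C1dD (C1dM c1 Cf) (C1dN (C1dM c2 Cg))) _ _ => x;
  rewrite /re_mode /im_mode; ring.
Qed.

Lemma C1d_im_mode k f f1 g g1 : (forall t, is_derive t (1 : R) f (f1 t)) ->
  (forall t, is_derive t (1 : R) g (g1 t)) -> continuous f1 -> continuous g1 ->
  C1d (im_mode k f g)
    (fun x => k%:R * im_mode k.-1 f g x + 2 * x.1 * im_mode k f1 g1 x)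
    (fun x => k%:R * re_mode k.-1 f g x + 2 * x.2 * im_mode k f1 g1 x).
Proof.
move=> df dg cf cg; have [c1 c2] := C1d_cpow k.
have Cf := C1d_comp df cf C1d_sqnorm; have Cg := C1d_comp dg cg C1d_sqnorm.
apply: C1d_eq (C1dD (C1dM c1 Cg) (C1dM c2 Cf)) _ _ => x;
  rewrite /re_mode /im_mode; ring.
Qed.

(** With N = k + 1 and s = |z|^2: z^N is harmonic, the cross term gives 4 N z^N g' and the radial
    factor 4 s g'' + 4 g', so the Laplacian is 4 z^N (s g'' + (N + 1) g'). The rotation x^perp .
    grad is the angular derivative, which ignores g(s) and multiplies z^N by i N. *)
Lemma re_mode_solution k (m om : R) p p1 p2 q q1 q2 :
  (forall t, is_derive t (1 : R) p (p1 t)) -> (forall t, is_derive t (1 : R) q (q1 t)) ->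
  (forall t, is_derive t (1 : R) p1 (p2 t)) -> (forall t, is_derive t (1 : R) q1 (q2 t)) ->
  continuous p2 -> continuous q2 ->
  (forall t, t * p2 t + k.+2%:R * p1 t = - (m / 4) * p t - om * k.+1%:R / 4 * q t /\
             t * q2 t + k.+2%:R * q1 t = - (m / 4) * q t + om * k.+1%:R / 4 * p t) ->
  let W := re_mode k.+1 p q in
  exists W1 W2 W11 W12 W21 W22, [/\ C1d W W1 W2, C1d W1 W11 W12, C1d W2 W21 W22 &
    forall x, W11 x + W22 x = om * dot2 (perp x) (W1 x, W2 x) - m * W x].
Proof.
move=> dp dq dp1 dq1 cp2 cq2 ode W.
have cp1 := is_derive_cont dp1; have cq1 := is_derive_cont dq1.
have f1 := @C1d_fst R; have f2 := @C1d_snd R.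
have cst2 := C1d_cst (2 : R); have cstk := C1d_cst (k.+1%:R : R).
have CW := C1d_re_mode k.+1 dp dq cp1 cq1.
have CT := C1d_re_mode k dp dq cp1 cq1.
have CS := C1d_im_mode k dp dq cp1 cq1.
have CT1 := C1d_re_mode k.+1 dp1 dq1 cp2 cq2.
do 6 eexists; split.
- exact: CW.
- exact: (C1dD (C1dM cstk CT) (C1dM (C1dM cst2 f1) CT1)).
- exact: (C1dD (C1dN (C1dM cstk CS)) (C1dM (C1dM cst2 f2) CT1)).
- move=> x; have [H1 H2] := ode (sqnorm x); rewrite /W.
  transitivity (4 * ((cpow k.+1 x).1 * (sqnorm x * p2 (sqnorm x) + k.+2%:R * p1 (sqnorm x)) -
    (cpow k.+1 x).2 * (sqnorm x * q2 (sqnorm x) + k.+2%:R * q1 (sqnorm x)))).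
    rewrite /re_mode /im_mode /dot2 /=.
    case: k {ode CW CT CS CT1 W cstk H1 H2} => [|k] /=; rewrite /sqnorm -?natr1 /=; ring.
  by rewrite H1 H2 /dot2 /re_mode /im_mode /=; field.
Qed.

End angular_modes.

(** * Absence of zeros and a continuous phase for g = p + i q *)

Section phase.
Context {R : realType}.
Implicit Types (p q f : R -> R) (s t : R).

Lemma mvt_global f (df : R -> R) (a b : R) : a < b ->
  (forall t, a < t < b -> is_derive t (1 : R) f (df t)) ->
  (forall t, a <= t <= b -> {for t, continuous f}) ->
  exists2 c, a < c < b & f b - f a = df c * (b - a).
Proof.
move=> ab hf cf.
have h1 t : t \in `]a, b[ -> is_derive t (1 : R) f (df t) by rewrite in_itv/=; exact: hf.
have h2 : {within `[a, b], continuous f}.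
  by apply: continuous_in_subspaceT => t; rewrite inE/= in_itv/=; exact: cf.
by have [c] := MVT ab h1 h2; rewrite in_itv/= => cab E; exists c.
Qed.

Variables (N : nat) (k1 k2 : R) (p p1 p2 q q1 q2 : R -> R).
Hypothesis dp : forall t, is_derive t (1 : R) p (p1 t).
Hypothesis dq : forall t, is_derive t (1 : R) q (q1 t).
Hypothesis dp1 : forall t, is_derive t (1 : R) p1 (p2 t).
Hypothesis dq1 : forall t, is_derive t (1 : R) q1 (q2 t).
Hypothesis ode : forall t, t * p2 t + N.+1%:R * p1 t = k1 * p t - k2 * q t /\
  t * q2 t + N.+1%:R * q1 t = k1 * q t + k2 * p t.
Hypothesis p0 : p 0 = 1.
Hypothesis q0 : q 0 = 0.
Hypothesis k2_neq0 : k2 != 0.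

Let cp : continuous p := is_derive_cont dp.
Let cq : continuous q := is_derive_cont dq.
Let cp1 : continuous p1 := is_derive_cont dp1.
Let cq1 : continuous q1 := is_derive_cont dq1.

(* The Wronskian [k2 s^(N+1) (p q' - q p')] is increasing because its derivative
   is [k2^2 s^N (p^2 + q^2)]; a common zero of [p] and [q] would be a zero of it. *)
Lemma no_common_zero s : 0 <= s -> 0 < p s ^+ 2 + q s ^+ 2.
Proof.
rewrite le_eqVlt => /orP[/eqP <-|s0]; first by rewrite p0 q0 expr1n expr0n addr0.
rewrite lt_neqAle addr_ge0 ?sqr_ge0// andbT eq_sym; apply/eqP => pq0.
have ps0 : p s = 0 by apply/eqP; rewrite -sqrf_eq0; apply/eqP; nra.
have qs0 : q s = 0 by apply/eqP; rewrite -sqrf_eq0; apply/eqP; nra.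
pose F t := k2 * (t ^+ N.+1 * (p t * q1 t - q t * p1 t)).
pose dF t := k2 ^+ 2 * t ^+ N * (p t ^+ 2 + q t ^+ 2).
have hF t : is_derive t (1 : R) F (dF t).
  have h0 : is_derive t (1 : R) (fun t => t ^+ N.+1) (N.+1%:R * t ^+ N).
    have := is_deriveX N.+1 (is_derive_id t (1 : R)); rewrite exprfctE => h.
    by apply: is_derive_eq h _; rewrite /GRing.scale/= mulr1.
  have h1 := is_deriveB (is_deriveM (dp t) (dq1 t)) (is_deriveM (dq t) (dp1 t)).
  apply: is_derive_eq (is_deriveZ k2 (is_deriveM h0 h1)) _.
  have [e e'] := ode t; rewrite /dF /GRing.scale/= exprS.
  transitivity (k2 * t ^+ N * (p t * (t * q2 t + N.+1%:R * q1 t) - q t * (t * p2 t + N.+1%:R * p1 t))).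
    by rewrite !fctE; ring.
  by rewrite e e'; ring.
have cF := is_derive_cont hF.
have F0 : F 0 = 0 by rewrite /F exprS !mul0r mulr0.
have Fs : F s = 0 by rewrite /F ps0 qs0 !mul0r subrr !mulr0.
have [d d0 pd] : exists2 d, 0 < d & forall t, 0 <= t < d -> 0 < p t.
  have : \forall t \near (0 : R), 0 < p t.
    by apply: (cvgr_gt (p 0) (cp (x := 0))); rewrite p0.
  move=> /nbhs_ballP[d /= d0 dB]; exists d => // t /andP[t0 td]; apply: dB.
  by rewrite /ball/= sub0r normrN ger0_norm.
(* Two mean value steps: on [[0, r]], where [p > 0] by continuity from [p 0 = 1], [F] strictly
   increases, so [F r > 0]; on [[r, s]] it does not decrease, which contradicts [F s = 0]. *)
pose r := Num.min (d / 2) (s / 2).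
have r0 : 0 < r by rewrite lt_min !divr_gt0.
have rd : r < d by rewrite gt_min; apply/orP; left; lra.
have rs : r < s by rewrite gt_min; apply/orP; right; lra.
have [c /andP[c0 cr] E1] := mvt_global r0 (fun t _ => hF t) (fun t _ => cF t).
have [e /andP[e0 es] E2] := mvt_global rs (fun t _ => hF t) (fun t _ => cF t).
have dFc : 0 < dF c.
  have pc : 0 < p c by apply: pd; rewrite (ltW c0) (lt_trans cr).
  have k22 : 0 < k2 ^+ 2 by rewrite exprn_even_gt0.
  apply: mulr_gt0; first by apply: mulr_gt0 => //; exact: exprn_gt0.
  by rewrite ltr_pwDl ?sqr_ge0// exprn_gt0.
have dFe : 0 <= dF e.
  apply: mulr_ge0; last by rewrite addr_ge0 ?sqr_ge0.
  by apply: mulr_ge0; [exact: sqr_ge0|rewrite exprn_ge0// ltW// (lt_trans r0)].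
move: E1 E2; rewrite F0 Fs subr0 sub0r => E1 E2.
have : 0 < F r by rewrite E1 subr0 mulr_gt0.
by have : 0 <= - F r; [rewrite E2 mulr_ge0// subr_ge0 ltW|lra].
Qed.

(** The imaginary part of g'/g, that is, the derivative of the argument of g. The absolute values
    extend it continuously to negative t, where g might vanish. *)
Let speed t := (p `|t| * q1 `|t| - q `|t| * p1 `|t|) / (p `|t| ^+ 2 + q `|t| ^+ 2).

Let speed_cont : continuous speed.
Proof.
have ca f : continuous f -> continuous (fun t : R => f `|t|).
  move=> cf t; apply: (@continuous_comp R R R (fun t => `|t|) f); last exact: cf.
  exact: norm_continuous.
have h1 := ca _ cp; have h2 := ca _ cq; have h3 := ca _ cp1; have h4 := ca _ cq1.
move=> t; apply: cvgM.
  by apply: cvgB; apply: cvgM; [exact: h1|exact: h4|exact: h2|exact: h3].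
apply: cvgV; first by rewrite gt_eqF// no_common_zero.
by apply: cvgD; apply: cvgM; [exact: h1|exact: h1|exact: h2|exact: h2].
Qed.

(** Integration starts at -1 so that 0 is an interior point and the derivative there is
    two-sided. *)
Lemma antiderivative f : continuous f ->
  exists F : R -> R, forall t, -1 < t -> is_derive t (1 : R) F (f t).
Proof.
move=> cf; exists (fun x => \int[@lebesgue_measure R]_(t in `[-1, x]) f t) => t t1.
have fi : (@lebesgue_measure R).-integrable `[-1, t + 1] (EFin \o f).
  apply: continuous_compact_integrable; first exact: segment_compact.
  exact: continuous_subspaceT.
have tt : t < t + 1 by rewrite ltrDl.
have [d1 d2] := continuous_FTC1_closed tt fi t1 (cf t).
by split=> //; rewrite -d2 derive1E.
Qed.

(** With phi the integral of [speed], [A + i B] is g e^(-i phi). It must stay on the positive real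
    axis: [B] solves a linear homogeneous equation with [B 0 = 0], and [A] starts at 1 and cannot
    vanish together with [B]. *)
Lemma phase_exists : exists phi : R -> R, forall s, 0 <= s -> {for s, continuous phi} /\
  exists2 A, 0 < A & p s = A * cos (phi s) /\ q s = A * sin (phi s).
Proof.
have [F hF] := antiderivative speed_cont.
pose phi t := F t - F 0.
have hphi t : -1 < t -> is_derive t (1 : R) phi (speed t).
  by move=> t1; have := is_deriveB (hF t t1) (is_derive_cst (F 0) t (1 : R)); rewrite subr0.
have phi0 : phi 0 = 0 by rewrite /phi subrr.
have cphi t : 0 <= t -> {for t, continuous phi}.
  move=> t0; apply: differentiable_continuous; apply/derivable1_diffP.
  by have [] := hphi t (lt_le_trans (ltrN10 _) t0).
pose A t := p t * cos (phi t) + q t * sin (phi t).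
pose B t := q t * cos (phi t) - p t * sin (phi t).
have AB t : A t ^+ 2 + B t ^+ 2 = p t ^+ 2 + q t ^+ 2.
  have := cos2Dsin2 (phi t); rewrite /A /B; move: (cos _) (sin _) => c s h.
  by transitivity ((p t ^+ 2 + q t ^+ 2) * (c ^+ 2 + s ^+ 2)); [ring|rewrite h mulr1].
have AB_gt0 t : 0 <= t -> 0 < A t ^+ 2 + B t ^+ 2 by rewrite AB; exact: no_common_zero.
have dcos t : -1 < t -> is_derive t (1 : R) (fun t => cos (phi t)) (- sin (phi t) * speed t).
  by move=> t1; exact: is_derive1_comp (is_derive_cos (phi t)) (hphi t t1).
have dsin t : -1 < t -> is_derive t (1 : R) (fun t => sin (phi t)) (cos (phi t) * speed t).
  by move=> t1; exact: is_derive1_comp (is_derive_sin (phi t)) (hphi t t1).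
have cA t : 0 <= t -> {for t, continuous A}.
  move=> t0; apply: cvgD; apply: cvgM; [exact: cp| |exact: cq|];
    (apply: (@continuous_comp R R R phi); first exact: cphi);
    [exact: continuous_cos|exact: continuous_sin].
have cB t : 0 <= t -> {for t, continuous B}.
  move=> t0; apply: cvgB; apply: cvgM; [exact: cq| |exact: cp|];
    (apply: (@continuous_comp R R R phi); first exact: cphi);
    [exact: continuous_cos|exact: continuous_sin].
(* The real part of g'/g, the logarithmic derivative of |g|. *)
pose l t := (p t * p1 t + q t * q1 t) / (p t ^+ 2 + q t ^+ 2).
have dB t : 0 <= t -> is_derive t (1 : R) B (l t * B t).
  move=> t0; have t1 := lt_le_trans (ltrN10 R) t0.
  apply: is_derive_eq (is_deriveB (is_deriveM (dq t) (dcos t t1)) (is_deriveM (dp t) (dsin t t1))) _.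
  rewrite /l /B /speed /GRing.scale/= ger0_norm//; field.
  by rewrite gt_eqF// no_common_zero.
(* [B] and |g| have the same logarithmic derivative [l], so this quotient is constant, hence equal
   to its value 0 at the origin. *)
pose E t := B t ^+ 2 / (p t ^+ 2 + q t ^+ 2).
have dE t : 0 <= t -> is_derive t (1 : R) E 0.
  move=> t0; have pq := no_common_zero t0.
  have dsq := is_deriveD (is_deriveM (dp t) (dp t)) (is_deriveM (dq t) (dq t)).
  have dinv := is_deriveV (lt0r_neq0 (pq : 0 < (p * p + q * q) t)) dsq.
  apply: is_derive_eq (is_deriveM (is_deriveM (dB t t0) (dB t t0)) dinv) _.
  rewrite /GRing.scale /= !fctE /l -?expr2; field.
  by rewrite gt_eqF.
have B0 t : 0 <= t -> B t = 0.
  rewrite le_eqVlt => /orP[/eqP <-|t0].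
    by rewrite /B phi0 sin0 q0 mul0r mulr0 subrr.
  have hE s : 0 <= s -> {for s, continuous E}.
    by move=> s0; apply: differentiable_continuous; apply/derivable1_diffP; case: (dE s s0).
  have [|s s0|c _] := @mvt_global E (fun=> 0) 0 t t0.
  - by move=> s /andP[/ltW s0 _]; exact: dE.
  - by apply: hE; case/andP: s0.
  rewrite mul0r => /eqP; rewrite subr_eq0 /E => /eqP Et.
  have : B t ^+ 2 / (p t ^+ 2 + q t ^+ 2) = 0.
    by rewrite Et /B phi0 sin0 q0 mul0r mulr0 subrr expr0n mul0r.
  move/eqP; rewrite mulf_eq0 sqrf_eq0 invr_eq0 => /orP[/eqP//|].
  by rewrite gt_eqF// no_common_zero// ltW.
have A0 t : 0 <= t -> 0 < A t.
  move=> t0; rewrite ltNge; apply/negP => At.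
  have A00 : A 0 = 1 by rewrite /A phi0 cos0 sin0 p0 mulr1 mulr0 addr0.
  have cA' : {within `[0, t], continuous A}.
    apply: continuous_in_subspaceT => s; rewrite inE/= in_itv/= => /andP[s0 _].
    exact: cA.
  have [|c] := @IVT R A 0 t 0 t0 cA'.
    by rewrite A00 ge_min le_max At ler01 orbT.
  rewrite in_itv/= => /andP[c0 _] Ac.
  by have := AB_gt0 c c0; rewrite Ac (B0 c c0) expr0n addr0 ltxx.
exists phi => s s0; split; first exact: cphi.
exists (A s); first exact: A0.
have := B0 s s0; have := cos2Dsin2 (phi s); rewrite /A /B.
move: (cos _) (sin _) => c d h e; split.
  by transitivity (p s * (c ^+ 2 + d ^+ 2) + d * (q s * c - p s * d)); [rewrite h e; ring|ring].
by transitivity (q s * (c ^+ 2 + d ^+ 2) - c * (q s * c - p s * d)); [rewrite h e; ring|ring].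
Qed.

End phase.

(** * Labelling the spiral sectors of {W < 0} *)

Section spiral_sectors.
Context {R : realType}.
Variables (k : nat) (p q phi : R -> R).
Hypothesis k_gt0 : (0 < k)%N.
Hypothesis phiP : forall s, 0 <= s -> {for s, continuous phi} /\
  exists2 A, 0 < A & p s = A * cos (phi s) /\ q s = A * sin (phi s).

Local Notation N := k.*2.
Let W := re_mode N p q.

Lemma cpow_polar n (r t : R) :
  cpow n (r * cos t, r * sin t) = (r ^+ n * cos (n%:R * t), r ^+ n * sin (n%:R * t)).
Proof.
elim: n => [|n IH]; first by rewrite /= expr0 !mul0r cos0 sin0 mulr1 mulr0.
rewrite /= IH /= exprS -natr1 mulrDl mul1r cosD sinD.
by congr pair; ring.
Qed.

(* Rotating [x] by [phi (|x| ^ 2) / N] straightens the nodal set into rays. *)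
Let rad (x : R * R) : R := Num.sqrt (sqnorm x).
Let ang (x : R * R) : R := phi (sqnorm x) / N%:R.
Let X (x : R * R) : R := x.1 * cos (ang x) - x.2 * sin (ang x).
Let Y (x : R * R) : R := x.1 * sin (ang x) + x.2 * cos (ang x).

Let sq_ge0 x : 0 <= sqnorm x :> R.
Proof. by rewrite addr_ge0 ?sqr_ge0. Qed.

Let rad_sq x : rad x ^+ 2 = sqnorm x.
Proof. by rewrite sqr_sqrtr. Qed.

Let XY_sq x : X x ^+ 2 + Y x ^+ 2 = rad x ^+ 2.
Proof.
rewrite rad_sq /X /Y /sqnorm; have := cos2Dsin2 (ang x); move: (cos _) (sin _) => c s h.
by transitivity ((x.1 ^+ 2 + x.2 ^+ 2) * (c ^+ 2 + s ^+ 2)); [ring|rewrite h mulr1].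
Qed.

Let N_neq0 : N%:R != 0 :> R.
Proof. by rewrite pnatr_eq0 double_eq0 -lt0n. Qed.

(** If [t] is a polar angle of the rotated point, then [x] has angle t - phi / N; raised to the
    power N this loses exactly phi, which the factor A e^(i phi) restores. *)
Let W_angle x (t : R) : X x = rad x * cos t -> Y x = rad x * sin t ->
  exists2 A, 0 < A & W x = A * (rad x ^+ N * cos (N%:R * t)).
Proof.
move=> hX hY; have [_ [A A0 [hp hq]]] := phiP (sq_ge0 x); exists A => //.
have hx : x = (rad x * cos (t - ang x), rad x * sin (t - ang x)).
  rewrite cosB sinB !mulrDr mulrN !mulrA -hX -hY /X /Y.
  have := cos2Dsin2 (ang x); move: (cos _) (sin _) => c s h.
  rewrite [LHS]surjective_pairing; congr pair.
    by transitivity (x.1 * (c ^+ 2 + s ^+ 2)); [rewrite h mulr1|ring].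
  by transitivity (x.2 * (c ^+ 2 + s ^+ 2)); [rewrite h mulr1|ring].
have hc : cpow N x = (rad x ^+ N * cos (N%:R * (t - ang x)), rad x ^+ N * sin (N%:R * (t - ang x))).
  by rewrite {1}hx cpow_polar.
rewrite /W /re_mode hc hp hq /=.
have -> : N%:R * t = N%:R * (t - ang x) + phi (sqnorm x).
  by rewrite /ang mulrBr mulrCA mulfV// mulr1 subrK.
by rewrite cosD; ring.
Qed.

Let rad_gt0 x : W x < 0 -> 0 < rad x.
Proof.
move=> Wx; rewrite lt_neqAle sqrtr_ge0 andbT eq_sym; apply/eqP => r0.
have /eqP := XY_sq x; rewrite r0 expr0n/= paddr_eq0 ?sqr_ge0// !sqrf_eq0.
move=> /andP[/eqP X0 /eqP Y0].
have [||A _] := @W_angle x 0; rewrite ?X0 ?Y0 ?r0 ?mul0r//.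
rewrite expr0n double_eq0 (gtn_eqF k_gt0) mul0r mulr0 => W0.
by rewrite W0 ltxx in Wx.
Qed.

Let acos_XY x : 0 < rad x -> 0 <= Y x -> let t := acos (X x / rad x) in
  [/\ 0 <= t <= pi, X x = rad x * cos t & Y x = rad x * sin t].
Proof.
move=> r0 Y0; have Xr : -1 <= X x / rad x <= 1.
  rewrite -ler_norml normrM normfV (gtr0_norm r0) ler_pdivrMr// mul1r.
  rewrite -[leRHS](gtr0_norm r0) -ler_sqr ?nnegrE// !real_normK ?num_real//.
  by rewrite -XY_sq lerDl sqr_ge0.
cbv zeta; split; first by rewrite acos_ge0// acos_lepi.
  by rewrite acosK ?in_itv//= mulrC divfK// gt_eqF.
rewrite sin_acos//; apply/eqP; rewrite -(eqrXn2 (n := 2))//; last first.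
  by rewrite mulr_ge0 ?sqrtr_ge0// ltW.
have hs : 0 <= 1 - (X x / rad x) ^+ 2.
  by move: (X x / rad x) Xr => u /andP[u1 u2]; nra.
rewrite exprMn (sqr_sqrtr hs); apply/eqP.
have -> : Y x ^+ 2 = rad x ^+ 2 - X x ^+ 2 by rewrite -XY_sq addrC addKr.
by field; rewrite gt_eqF.
Qed.

Let cos_full n : cos (n%:R * (pi *+ 2)) = 1 :> R.
Proof. by have := periodicn (@cosD2pi R) n 0; rewrite add0r cos0 mulr_natl. Qed.

Let N_pi (t : R) : N%:R * t = k%:R * t / pi * (pi *+ 2).
Proof.
have pi0 : (pi : R) != 0 by rewrite gt_eqF// pi_gt0.
rewrite -mul2n natrM mulr2n mulrDr divfK//; ring.
Qed.

Let W_cos x (t : R) : W x < 0 -> X x = rad x * cos t -> Y x = rad x * sin t -> cos (N%:R * t) < 0.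
Proof.
move=> Wx hX hY; have r0 := rad_gt0 Wx; have [A A0 E] := W_angle hX hY; move: Wx.
by rewrite E pmulr_rlt0// pmulr_rlt0// exprn_gt0.
Qed.

(** On the straightened axis the angle is 0 or pi, and since N = 2 k the cosine of N times it is 1
    in both cases. *)
Let Y_neq0 x : W x < 0 -> Y x != 0.
Proof.
move=> Wx; apply/eqP => Y0; have r0 := rad_gt0 Wx.
have : X x = rad x \/ X x = - rad x.
  have := eqf_sqr (X x) (rad x); rewrite -XY_sq Y0 expr0n addr0 eqxx.
  by move=> /esym/orP[/eqP|/eqP]; [left|right].
case=> hX.
  have := @W_cos x 0 Wx; rewrite cos0 sin0 mulr1 mulr0 mulr0 cos0 => /(_ hX Y0).
  by rewrite ltNge ler01.
have := @W_cos x pi Wx; rewrite cospi sinpi mulrN1 mulr0 => /(_ hX Y0).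
rewrite N_pi mulfK ?gt_eqF ?pi_gt0// cos_full.
by rewrite ltNge ler01.
Qed.

(** The number of full turns of N times the polar angle, for angles in [0, pi]. Each unit interval
    between integers contains one negative sector of the upper half-plane, and at integers [W] is
    nonnegative. *)
Let turn x : R := k%:R * acos (X x / rad x) / pi.

(** Every sector below the axis gets the label 0. The jump across [Y = 0] is invisible on {W < 0},
    which does not meet that axis. *)
Definition sector x : nat := if 0 < Y x then Num.truncn (turn x) else 0.

Let turn_sector x : W x < 0 -> 0 < Y x -> (sector x)%:R < turn x < (sector x).+1%:R.
Proof.
move=> Wx Yx; have r0 := rad_gt0 Wx; have [t0 hX hY] := acos_XY r0 (ltW Yx).
have turn0 : 0 <= turn x.
  by rewrite /turn divr_ge0 ?mulr_ge0 ?pi_ge0//; case/andP: t0.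
have /andP[h1 h2] := truncn_itv turn0; rewrite /sector Yx h2 andbT lt_neqAle h1 andbT.
apply/eqP => E; have := W_cos Wx hX hY; rewrite N_pi -/(turn x) -E cos_full.
by rewrite ltNge ler01.
Qed.

Let cont_at x : W x < 0 -> [/\ {for x, continuous X}, {for x, continuous Y} &
  {for x, continuous rad}].
Proof.
move=> Wx; have [csq _ _ _ _] := @C1d_sqnorm R.
have cang : {for x, continuous ang}.
  apply: cvgM; last exact: cvg_cst.
  apply: (@continuous_comp _ _ _ sqnorm phi); first exact: csq.
  by have [] := phiP (sq_ge0 x).
have cc : {for x, continuous (fun y => cos (ang y))}.
  by apply: (@continuous_comp _ _ _ ang); [exact: cang|exact: continuous_cos].
have cs : {for x, continuous (fun y => sin (ang y))}.
  by apply: (@continuous_comp _ _ _ ang); [exact: cang|exact: continuous_sin].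
have c1 : {for x, continuous (fun y : R * R => y.1)} by exact: cvg_fst.
have c2 : {for x, continuous (fun y : R * R => y.2)} by exact: cvg_snd.
split.
- by apply: cvgB; apply: cvgM; [exact: c1|exact: cc|exact: c2|exact: cs].
- by apply: cvgD; apply: cvgM; [exact: c1|exact: cs|exact: c2|exact: cc].
- by apply: (@continuous_comp _ _ _ sqnorm Num.sqrt); [exact: csq|exact: sqrt_continuous].
Qed.

Lemma sector_locally_constant x : W x < 0 -> \forall y \near x, sector y = sector x.
Proof.
move=> Wx; have [cX cY cr] := cont_at Wx.
have [Yx|Yx|Yx] := ltgtP (Y x) 0.
- near=> y; rewrite /sector [in RHS]ltNge (ltW Yx)/= ltNge ifF//; apply/negbF/ltW.
  by near: y; exact: (cvgr_lt _ cY).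
- have r0 := rad_gt0 Wx; have [_ hX hY] := acos_XY r0 (ltW Yx).
  (* [Y x > 0] makes the bound strict, which places the quotient where [acos] is continuous. *)
  have Xr : -1 < X x / rad x < 1.
    rewrite -ltr_norml normrM normfV (gtr0_norm r0) ltr_pdivrMr// mul1r.
    rewrite -[ltRHS](gtr0_norm r0) -ltr_sqr ?nnegrE// !real_normK ?num_real//.
    by rewrite -XY_sq ltrDl exprn_gt0.
  have cturn : {for x, continuous turn}.
    apply: cvgM; last exact: cvg_cst.
    apply: cvgM; first exact: cvg_cst.
    apply: (@continuous_comp _ _ _ (fun y => X y / rad y) (@acos R)).
      by apply: cvgM; [exact: cX|apply: cvgV; [rewrite gt_eqF|exact: cr]].
    exact: continuous_acos.
  have /andP[t1 t2] := turn_sector Wx Yx.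
  near=> y; have Yy : 0 < Y y by near: y; exact: (cvgr_gt _ cY).
  rewrite {1}/sector Yy; apply: truncn_def; apply/andP; split.
    by apply: ltW; near: y; exact: (cvgr_gt _ cturn).
  by near: y; exact: (cvgr_lt _ cturn).
- by have := Y_neq0 Wx; rewrite Yx eqxx.
Unshelve. all: by end_near. Qed.

Lemma sector_onto j : (j < k)%N -> exists x, W x < 0 /\ sector x = j.
Proof.
(* The midline of the sector: there N t = (2 j + 1) pi with cosine -1, and [turn] is j + 1/2, which
   truncates to j. *)
move=> jk; pose t : R := (j%:R + 2^-1) * pi / k%:R.
have k0 : 0 < k%:R :> R by rewrite ltr0n.
have pi0 := @pi_gt0 R.
have t0 : 0 < t by rewrite /t divr_gt0// mulr_gt0// ltr_wpDl// invr_gt0.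
have tpi : t < pi.
  rewrite /t ltr_pdivrMr// mulrC ltr_pM2l//.
  have : j.+1%:R <= k%:R :> R by rewrite ler_nat.
  by rewrite -natr1; lra.
(* On the unit circle the straightening is the rotation by [b], so the point of angle t - b is
   carried to angle t. *)
pose b := phi 1 / N%:R.
exists (cos (t - b), sin (t - b)); set x := (cos _, sin _).
have sx : sqnorm x = 1 by rewrite /sqnorm /= cos2Dsin2.
have rx : rad x = 1 by rewrite /rad sx sqrtr1.
have ax : ang x = b by rewrite /ang sx.
have hX : X x = cos t.
  by rewrite /X ax /= -cosD subrK.
have hY : Y x = sin t.
  by rewrite /Y ax /= addrC -sinD subrK.
have s0 : 0 < sin t by rewrite sin_gt0_pi// t0 tpi.
have [||A A0 WE] := @W_angle x t; rewrite ?rx ?mul1r//.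
split.
  rewrite WE rx expr1n mul1r pmulr_rlt0// N_pi.
  have -> : k%:R * t / pi = j%:R + 2^-1 by rewrite /t; move: (pi : R) pi0 => c c0; field; rewrite !gt_eqF.
  rewrite (_ : _ * _ = pi + (pi *+ 2) *+ j); last first.
    by rewrite -(mulr_natl _ j); move: (pi : R) => c; rewrite mulr2n; field.
  by rewrite (periodicn (@cosD2pi R)) cospi ltrN10.
rewrite /sector hY s0 /turn hX rx divr1 cosK ?in_itv/= ?(ltW t0) ?(ltW tpi)//.
have -> : k%:R * t / pi = j%:R + 2^-1 by rewrite /t; move: (pi : R) pi0 => c c0; field; rewrite !gt_eqF.
by apply: truncn_def; rewrite lerDl invr_ge0 ler0n/= -[j.+1%:R]natr1 ltrD2l invf_lt1// ltr1n.
Qed.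

Lemma mode_pos : exists x, 0 < W x.
Proof.
pose b := phi 1 / N%:R; pose x : R * R := (cos (- b), sin (- b)).
have sx : sqnorm x = 1 by rewrite /sqnorm /= cos2Dsin2.
have rx : rad x = 1 by rewrite /rad sx sqrtr1.
have ax : ang x = b by rewrite /ang sx.
exists x; have [||A A0 ->] := @W_angle x 0.
- by rewrite /X ax rx /= -cosD addNr mul1r.
- by rewrite /Y ax rx /= addrC -sinD addNr mul1r.
- by rewrite rx expr1n mulr0 cos0 !mulr1.
Qed.

End spiral_sectors.

(** * Assembly for nonzero omega *)

Lemma rotating_solution {R : realType} (K : nat) (a : 'I_K -> 'I_K -> R) (m om : R) : (3 <= K)%N ->
  (forall i j, i != j -> 0 < a i j) -> om != 0 ->
  exists u, entire_segregated_solution a m om u.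
Proof.
case: K a => [//|[//|k]] a _ ha om0.
(* With K = k + 2 there are k + 1 leaves, and l + 1 = 2 (k + 1) is the exponent N of the mode. *)
pose l := k.*2.+1.
have k2 : om * l.+1%:R / 4 != 0 by rewrite !mulf_neq0 ?invr_eq0 ?pnatr_eq0.
have [p [p1 [p2 [q [q1 [q2 [[dp dq] [dp1 dq1] [cp2 cq2] ode [p0 q0]]]]]]]] :=
  frobenius_solution l.+1 (- (m / 4)) (om * l.+1%:R / 4).
have [phi phiP] := phase_exists dp dq dp1 dq1 ode p0 q0 k2.
have [W1 [W2 [W11 [W12 [W21 [W22 [CW CW1 CW2 eqW]]]]]]] :=
  re_mode_solution dp dq dp1 dq1 cp2 cq2 ode.
(* Index 0 is the centre, so labels are shifted by one; the cap at k + 1 keeps the value in range at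
   every point of the plane. *)
pose col x : 'I_k.+2 := inord (minn (sector k.+1 phi x).+1 k.+1).
have colE x : nat_of_ord (col x) = minn (sector k.+1 phi x).+1 k.+1.
  by rewrite inordK// ltnS geq_minr.
apply: (star_solution CW CW1 CW2 eqW (i0 := ord0) (col := col) ha) => //.
- by move=> x _; rewrite -val_eqE /= colE -lt0n leq_min.
- move=> x Wx; have := @sector_locally_constant R k.+1 p q phi isT phiP x Wx.
  by apply: filterS => y sy; rewrite /col sy.
- move=> j j0; have jk : (j.-1 < k.+1)%N by rewrite prednK ?lt0n// -ltnS ltn_ord.
  have [x [Wx sx]] := @sector_onto R k.+1 p q phi isT phiP _ jk.
  exists x; split=> //; apply/val_inj; rewrite /= colE sx prednK ?lt0n//.
  by apply/minn_idPl; rewrite -ltnS ltn_ord.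
- exact: (@mode_pos R k.+1 p q phi isT phiP).
Qed.

Unset Implicit Arguments.

Theorem theorem1p6 (R : realType) (K : nat) (a : 'I_K -> 'I_K -> R)
    (hK : (3 <= K)%N) (ha : forall i j : 'I_K, i != j -> 0 < a i j) :
  {ae (plane_measure R), forall p : R * R,
    exists u : 'I_K -> R * R -> R, entire_segregated_solution a p.1 p.2 u}.
Proof.
(* The exceptional set is the line omega = 0, where the coefficient [k2] of the Wronskian argument
   vanishes. It is null because an infinite measure times 0 is 0. *)
exists (setT `*` [set 0]); split.
- by apply: measurableX => //; exact: measurable_set1.
- rewrite product_measure1E//.
  by rewrite /= lebesgue_measure_set1 mule0.
- move=> [m om] /= h; split=> //; apply/eqP; apply: contra_notT h => om0.
  exact: rotating_solution.
Qed.
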